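(* Let $C_n$ be a primitive multiple curve of multiplicity $n$ and let $0\to\mathcal{E}\to\mathcal{F}\to\mathcal{G}\to 0$ be an exact sequence of torsion free coherent sheaves on $C_n$. Then the dual sequence $0\to\mathcal{G}^\vee\to\mathcal{F}^\vee\to\mathcal{E}^\vee\to 0$ is also exact.
   Context: We work over $\mathbb{C}$. A primitive multiple curve is a Cohen–Macaulay complex algebraic variety (scheme of finite type, not necessarily reduced) $C_n$ such that the reduced subscheme $C=(C_n)_{red}$ is a smooth irreducible curve and every closed point has a neighbourhood that can be embedded in a smooth surface $S$; its multiplicity is the integer $n$ such that locally, if $z$ generates the ideal of $C$ in $\mathcal{O}_{S,P}$, the ideal of $C_n$ is $(z^n)$. A coherent sheaf on $C_n$ is torsion free if it has no nonzero subsheaf with finite support. The dual is $\mathcal{E}^\vee=\mathcal{H}om(\mathcal{E},\mathcal{O}_{C_n})$. *)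

(* Defs.v *)
From HB Require Import structures.
From mathcomp Require Import all_boot all_order all_algebra.
From mathcomp Require Import generic_quotient.
From mathcomp Require Import all_classical all_reals all_analysis.
From mathcomp Require Import complex.

Set Implicit Arguments.
Unset Strict Implicit.
Unset Printing Implicit Defensive.

Import GRing.Theory.
Local Open Scope classical_set_scope.
Local Open Scope ring_scope.
Local Open Scope quotient_scope.

(* Rings are [comPzRingType]s: the zero ring must be allowed, being the ring of
   sections over the empty set. *)

Section CommutativeAlgebra.
Variable A : comPzRingType.
Implicit Types (a b x : A) (I : set A).

Definition is_unit a := exists b, a * b = 1.

Definition nonunits : set A := [set a | ~ is_unit a].

Definition is_ideal I :=
  [/\ I 0, forall a b, I a -> I b -> I (a + b) & forall a b, I b -> I (a * b)].

Definition prime_ideal I :=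
  [/\ is_ideal I, ~ I 1 & forall a b, I (a * b) -> I a \/ I b].

Definition generated m (g : 'I_m -> A) : set A :=
  [set a | exists c : 'I_m -> A, a = \sum_(i < m) c i * g i].

Definition principal x : set A := [set a | exists b, a = b * x].

Definition noetherian :=
  forall I, is_ideal I -> exists m (g : 'I_m -> A), I = generated g.

Definition local_ring := is_ideal nonunits.

Definition prime_chain d :=
  exists p : nat -> set A,
    (forall i, (i <= d)%N -> prime_ideal (p i)) /\
    (forall i, (i < d)%N -> p i `<` p i.+1).

Definition krull_dim d := prime_chain d /\ ~ prime_chain d.+1.

Definition regular_local_ring d :=
  [/\ noetherian, local_ring, krull_dim d &
      exists g : 'I_d -> A, nonunits = generated g].

(* In a local ring the condition A / (x 0, ..., x d.-1) <> 0 is automatic for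
   a sequence of elements of the maximal ideal. *)
Definition regular_sequence d (x : nat -> A) :=
  forall i, (i < d)%N -> nonunits (x i) /\
    forall a, generated (fun j : 'I_i => x j) (x i * a) ->
              generated (fun j : 'I_i => x j) a.

Definition depth d :=
  (exists x : nat -> A, regular_sequence d x) /\
  ~ (exists x : nat -> A, regular_sequence d.+1 x).

Definition cohen_macaulay_local_ring :=
  [/\ noetherian, local_ring & exists2 d, krull_dim d & depth d].

(* phi : A -> B identifies B with A[1/f] *)
Definition is_localization (B : comPzRingType) (phi : A -> B) (f : A) :=
  [/\ exists c, phi f * c = 1,
      forall b : B, exists a k, b * phi f ^+ k = phi a &
      forall a, phi a = 0 -> exists k, f ^+ k * a = 0].

Definition subring (S : set A) :=
  [/\ S 1, forall a b, S a -> S b -> S (a - b)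
    & forall a b, S a -> S b -> S (a * b)].

Definition finitely_generated_algebra (K : comPzRingType) (str : K -> A) :=
  exists m (g : 'I_m -> A), forall S : set A, subring S ->
    (forall c, S (str c)) -> (forall i, S (g i)) -> S = setT.

End CommutativeAlgebra.

Record opens (X : topologicalType) :=
  Opens { oset :> set X ; open_oset : open oset }.

Definition opensT (X : topologicalType) : opens X := Opens (@openT X).

Definition opensI (X : topologicalType) (U V : opens X) : opens X :=
  Opens (openI (open_oset U) (open_oset V)).

Lemma opens_subT (X : topologicalType) (U : opens X) : U `<=` opensT X.
Proof. exact: subsetT. Qed.

Lemma opensIl (X : topologicalType) (U V : opens X) : opensI U V `<=` U.
Proof. by move=> y []. Qed.

Lemma opensIr (X : topologicalType) (U V : opens X) : opensI U V `<=` V.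
Proof. by move=> y []. Qed.

Lemma open_preim (X Y : topologicalType) (f : X -> Y) (V : opens Y) :
  continuous f -> open (f @^-1` V).
Proof. by move=> /continuousP; apply; exact: open_oset. Qed.

Definition opreim (X Y : topologicalType) (f : X -> Y) (cf : continuous f)
    (V : opens Y) : opens X :=
  Opens (open_preim V cf).

Definition sheaf_axiom (X : topologicalType) (S : opens X -> Type)
    (res : forall U V : opens X, V `<=` U -> S U -> S V) :=
  forall (U : opens X) (I : Type) (V : I -> opens X)
    (hV : forall i, V i `<=` U) (s : forall i, S (V i)),
  U `<=` \bigcup_i V i ->
  (forall i j (W : opens X) (hi : W `<=` V i) (hj : W `<=` V j),
     res _ _ hi (s i) = res _ _ hj (s j)) ->
  exists! t : S U, forall i, res _ _ (hV i) t = s i.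

(* A topological space with a sheaf of commutative K-algebras *)
Record ringedSpace (K : comPzRingType) := RingedSpace {
  space :> topologicalType;
  sect : opens space -> comPzRingType;
  res : forall U V : opens space, V `<=` U -> {rmorphism sect U -> sect V};
  str : forall U : opens space, {rmorphism K -> sect U};
  res_id : forall (U : opens space) (h : U `<=` U) s, res h s = s;
  res_comp : forall (U V W : opens space) (h : V `<=` U) (h' : W `<=` V)
    (h'' : W `<=` U) s, res h' (res h s) = res h'' s;
  res_str : forall (U V : opens space) (h : V `<=` U) c,
    res h (str U c) = str V c;
  res_sheaf : sheaf_axiom (fun U V h => res h : sect U -> sect V) }.

Lemma res_comp2 (K : comPzRingType) (X : ringedSpace K) (U V V' W : opens X)
    (h : V `<=` U) (k : W `<=` V) (h' : V' `<=` U) (k' : W `<=` V') (s : sect U) :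
  res k (res h s) = res k' (res h' s).
Proof. by rewrite (res_comp _ _ (subset_trans k h)) (res_comp _ _ (subset_trans k h)). Qed.

Section Stalks.
Variables (K : comPzRingType) (X : ringedSpace K) (x : X).

Record pregerm := Pregerm {
  germ_dom : opens X ; germ_in : oset germ_dom x ; germ_val : sect germ_dom }.

HB.instance Definition _ := gen_eqMixin pregerm.
HB.instance Definition _ := gen_choiceMixin pregerm.

Definition germ_eqv (a b : pregerm) : bool :=
  `[< exists (W : opens X) (ha : W `<=` germ_dom a) (hb : W `<=` germ_dom b),
        oset W x /\ res ha (germ_val a) = res hb (germ_val b) >].

Lemma germ_eqv_equiv : equiv_class_of germ_eqv.
Proof.
split=> [a|a b|b a c].
- apply/asboolP; exists (germ_dom a), (@subset_refl _ _), (@subset_refl _ _).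
  by split=> //; exact: germ_in.
- by apply/asboolP/asboolP => -[W [ha [hb [Wx e]]]]; exists W, hb, ha.
- move=> /asboolP[W [ha [hb [Wx e]]]] /asboolP[W' [hb' [hc [Wx' e']]]].
  apply/asboolP; exists (opensI W W').
  exists (subset_trans (@opensIl _ _ _) ha), (subset_trans (@opensIr _ _ _) hc).
  split=> //.
  rewrite -(res_comp ha (@opensIl _ _ _)) e -(res_comp hc (@opensIr _ _ _)) -e'.
  exact: res_comp2.
Qed.

Canonical germ_equiv_rel := EquivRelPack germ_eqv_equiv.

Definition stalk := {eq_quot germ_equiv_rel}.
HB.instance Definition _ := Choice.on stalk.

Definition germ (U : opens X) (Ux : oset U x) (s : sect U) : stalk :=
  \pi_(stalk) (Pregerm Ux s).

Lemma germ_eq (U V : opens X) (Ux : oset U x) (Vx : oset V x) (s : sect U) (t : sect V) :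
  germ Ux s = germ Vx t <->
  exists (W : opens X) (hU : W `<=` U) (hV : W `<=` V),
    oset W x /\ res hU s = res hV t.
Proof. by split=> [/eqquotP/asboolP|h]; [|apply/eqquotP/asboolP]. Qed.

Lemma germ_res (U V : opens X) (h : V `<=` U) (Ux : oset U x) (Vx : oset V x) s :
  germ Vx (res h s) = germ Ux s.
Proof.
apply/germ_eq; exists V, (@subset_refl _ _), h; split=> //.
by rewrite res_id.
Qed.

Lemma germ_surj (a : stalk) : exists (U : opens X) (Ux : oset U x) s, a = germ Ux s.
Proof.
exists (germ_dom (repr a)), (germ_in (repr a)), (germ_val (repr a)).
rewrite -[LHS]reprK /germ; by case: (repr a).
Qed.

Lemma germ_surj2 (a b : stalk) :
  exists (U : opens X) (Ux : oset U x) s t, a = germ Ux s /\ b = germ Ux t.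
Proof.
have [U [Ux [s ->]]] := germ_surj a; have [V [Vx [t ->]]] := germ_surj b.
exists (opensI U V), (conj Ux Vx), (res (@opensIl _ _ _) s), (res (@opensIr _ _ _) t).
by rewrite !germ_res.
Qed.

Lemma germ_surj3 (a b c : stalk) :
  exists (U : opens X) (Ux : oset U x) s t r,
    [/\ a = germ Ux s, b = germ Ux t & c = germ Ux r].
Proof.
have [U [Ux [s [t [-> ->]]]]] := germ_surj2 a b.
have [V [Vx [r ->]]] := germ_surj c.
exists (opensI U V), (conj Ux Vx), (res (@opensIl _ _ _) s), (res (@opensIl _ _ _) t), (res (@opensIr _ _ _) r).
by rewrite !germ_res.
Qed.

Definition stalk_op2 (op : forall U : opens X, sect U -> sect U -> sect U)
    (a b : stalk) : stalk :=
  germ (conj (germ_in (repr a)) (germ_in (repr b))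
        : oset (opensI (germ_dom (repr a)) (germ_dom (repr b))) x)
    (op _ (res (@opensIl _ _ _) (germ_val (repr a)))
          (res (@opensIr _ _ _) (germ_val (repr b)))).

Definition stalk_op1 (op : forall U : opens X, sect U -> sect U) (a : stalk)
    : stalk := germ (germ_in (repr a)) (op _ (germ_val (repr a))).

Lemma stalk_op2E op (U : opens X) (Ux : oset U x) s t :
  (forall (V W : opens X) (h : W `<=` V) r r',
     res h (op V r r') = op W (res h r) (res h r')) ->
  stalk_op2 op (germ Ux s) (germ Ux t) = germ Ux (op U s t).
Proof.
move=> opres; rewrite /stalk_op2.
set a := repr _; set b := repr _.
have /germ_eq[W [h1 [h2 [Wx e]]]] : germ (germ_in a) (germ_val a) = germ Ux s.
  by rewrite -[RHS]reprK /germ -/a; case: (a).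
have /germ_eq[W' [h1' [h2' [Wx' e']]]] : germ (germ_in b) (germ_val b) = germ Ux t.
  by rewrite -[RHS]reprK /germ -/b; case: (b).
apply/germ_eq; exists (opensI W W').
exists (@setISS _ _ _ _ _ h1 h1'), (subset_trans (@opensIl _ _ _) h2); split=> //.
rewrite !opres -(res_comp h2 (@opensIl _ _ _) _ s) -e.
rewrite -(res_comp h2' (@opensIr _ _ _) _ t) -e'.
by congr (op _ _ _); exact: res_comp2.
Qed.

Lemma stalk_op1E op (U : opens X) (Ux : oset U x) s :
  (forall (V W : opens X) (h : W `<=` V) r, res h (op V r) = op W (res h r)) ->
  stalk_op1 op (germ Ux s) = germ Ux (op U s).
Proof.
move=> opres; rewrite /stalk_op1; set a := repr _.
have /germ_eq[W [h1 [h2 [Wx e]]]] : germ (germ_in a) (germ_val a) = germ Ux s.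
  by rewrite -[RHS]reprK /germ -/a; case: (a).
apply/germ_eq; exists W, h1, h2; split=> //.
by rewrite !opres e.
Qed.

Definition stalk_zero : stalk := germ (I : oset (opensT X) x) 0.
Definition stalk_one : stalk := germ (I : oset (opensT X) x) 1.
Definition stalk_add := stalk_op2 (fun U (s t : sect U) => s + t).
Definition stalk_mul := stalk_op2 (fun U (s t : sect U) => s * t).
Definition stalk_opp := stalk_op1 (fun U (s : sect U) => - s).

Lemma germ0 (U : opens X) (Ux : oset U x) : germ Ux 0 = stalk_zero.
Proof. by rewrite /stalk_zero -(germ_res (@opens_subT _ _) I Ux) rmorph0. Qed.

Lemma germ1 (U : opens X) (Ux : oset U x) : germ Ux 1 = stalk_one.
Proof. by rewrite /stalk_one -(germ_res (@opens_subT _ _) I Ux) rmorph1. Qed.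

Lemma germD (U : opens X) (Ux : oset U x) s t :
  stalk_add (germ Ux s) (germ Ux t) = germ Ux (s + t).
Proof. by rewrite [LHS]stalk_op2E// => *; rewrite rmorphD. Qed.

Lemma germM (U : opens X) (Ux : oset U x) s t :
  stalk_mul (germ Ux s) (germ Ux t) = germ Ux (s * t).
Proof. by rewrite [LHS]stalk_op2E// => *; rewrite rmorphM. Qed.

Lemma germN (U : opens X) (Ux : oset U x) s :
  stalk_opp (germ Ux s) = germ Ux (- s).
Proof. by rewrite [LHS]stalk_op1E// => *; rewrite rmorphN. Qed.

Lemma stalk_addA : associative stalk_add.
Proof.
move=> a b c; have [U [Ux [s [t [r [-> -> ->]]]]]] := germ_surj3 a b c.
by rewrite !germD addrA.
Qed.

Lemma stalk_addC : commutative stalk_add.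
Proof.
move=> a b; have [U [Ux [s [t [-> ->]]]]] := germ_surj2 a b.
by rewrite !germD addrC.
Qed.

Lemma stalk_add0 : left_id stalk_zero stalk_add.
Proof.
move=> a; have [U [Ux [s ->]]] := germ_surj a.
by rewrite -(germ0 Ux) germD add0r.
Qed.

Lemma stalk_addN : left_inverse stalk_zero stalk_opp stalk_add.
Proof.
move=> a; have [U [Ux [s ->]]] := germ_surj a.
by rewrite germN germD addNr germ0.
Qed.

Lemma stalk_mulA : associative stalk_mul.
Proof.
move=> a b c; have [U [Ux [s [t [r [-> -> ->]]]]]] := germ_surj3 a b c.
by rewrite !germM mulrA.
Qed.

Lemma stalk_mulC : commutative stalk_mul.
Proof.
move=> a b; have [U [Ux [s [t [-> ->]]]]] := germ_surj2 a b.
by rewrite !germM mulrC.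
Qed.

Lemma stalk_mul1 : left_id stalk_one stalk_mul.
Proof.
move=> a; have [U [Ux [s ->]]] := germ_surj a.
by rewrite -(germ1 Ux) germM mul1r.
Qed.

Lemma stalk_mulDl : left_distributive stalk_mul stalk_add.
Proof.
move=> a b c; have [U [Ux [s [t [r [-> -> ->]]]]]] := germ_surj3 a b c.
by rewrite !(germD, germM) mulrDl.
Qed.

HB.instance Definition _ :=
  GRing.isZmodule.Build stalk stalk_addA stalk_addC stalk_add0 stalk_addN.
HB.instance Definition _ :=
  GRing.Zmodule_isComPzRing.Build stalk
    stalk_mulA stalk_mulC stalk_mul1 stalk_mulDl.

End Stalks.

(* [pull_local]: the maps on stalks are local homomorphisms *)
Record morphism (K : comPzRingType) (X Y : ringedSpace K) := Morphism {
  mor :> X -> Y;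
  mor_cont : continuous mor;
  pull : forall V : opens Y, {rmorphism sect V -> sect (opreim mor_cont V)};
  pull_res : forall (U V : opens Y) (h : V `<=` U)
    (h' : opreim mor_cont V `<=` opreim mor_cont U) s,
    pull V (res h s) = res h' (pull U s);
  pull_str : forall (V : opens Y) c, pull V (str V c) = str _ c;
  pull_local : forall x (V : opens Y) (Vy : oset V (mor x)) (s : sect V),
    is_unit (germ (Vy : oset (opreim mor_cont V) x) (pull V s)) ->
    is_unit (germ Vy s) }.

(* The map on stalks, with y propositionally equal to f x *)
Section StalkMap.
Variables (K : comPzRingType) (X Y : ringedSpace K) (f : morphism X Y).
Variables (x : X) (y : Y) (e : f x = y).

Lemma in_preim (V : opens Y) : oset V y -> oset (opreim (@mor_cont _ _ _ f) V) x.
Proof. by rewrite -e. Qed.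

Definition stalk_map (a : stalk y) : stalk x :=
  germ (in_preim (germ_in (repr a))) (pull f _ (germ_val (repr a))).

Lemma stalk_map_germ (V : opens Y) (Vy : oset V y) (s : sect V) :
  stalk_map (germ Vy s) = germ (in_preim Vy) (pull f V s).
Proof.
rewrite /stalk_map; set a := repr _.
have /germ_eq[W [h1 [h2 [Wy er]]]] : germ (germ_in a) (germ_val a) = germ Vy s.
  by rewrite -[RHS]reprK /germ -/a; case: (a).
apply/germ_eq.
exists (opreim (@mor_cont _ _ _ f) W), (fun z => h1 (f z)), (fun z => h2 (f z)).
by split; [exact: in_preim|rewrite -!pull_res er].
Qed.

Lemma stalk_map_is_zmod_morphism : zmod_morphism stalk_map.
Proof.
move=> a b; have [U [Uy [s [t [-> ->]]]]] := germ_surj2 a b.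
rewrite [germ Uy s - _](_ : _ = germ Uy (s - t)).
  rewrite !stalk_map_germ rmorphB.
  by rewrite /GRing.opp/= /GRing.add/= germN germD.
by rewrite /GRing.opp/= /GRing.add/= germN germD.
Qed.

Lemma stalk_map_is_monoid_morphism : monoid_morphism stalk_map.
Proof.
split=> [|a b].
  by rewrite [1]/(stalk_one y) stalk_map_germ rmorph1 germ1.
have [U [Uy [s [t [-> ->]]]]] := germ_surj2 a b.
rewrite [germ Uy s * _](germM Uy s t) !stalk_map_germ rmorphM.
by rewrite /GRing.mul/= germM.
Qed.

HB.instance Definition _ := GRing.isZmodMorphism.Build (stalk y) (stalk x)
  stalk_map stalk_map_is_zmod_morphism.
HB.instance Definition _ := GRing.isMonoidMorphism.Build (stalk y) (stalk x)
  stalk_map stalk_map_is_monoid_morphism.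

End StalkMap.

Section Schemes.
Variable K : comPzRingType.
Implicit Types X Y C U S : ringedSpace K.

(* Y is isomorphic to Spec A: [pt] identifies Y with the set of prime ideals of
   A, the closed sets are the V(J), and the sections over D(f) are A[1/f],
   compatibly with restriction. *)
Definition is_spec (A : comPzRingType) Y :=
  exists (pt : Y -> set A) (theta : {rmorphism A -> sect (opensT Y)}),
  [/\ injective pt /\ range pt = [set p | prime_ideal p],
      forall U : set Y,
        open U <-> exists J : set A, U = [set y | ~ J `<=` pt y] &
      forall (f : A) (D : opens Y), D = [set y | ~ pt y f] :> set Y ->
        is_localization (fun a => res (@opens_subT _ D) (theta a)) f].

Definition affine Y := exists A, is_spec A Y.

Definition open_immersion X Y (k : morphism X Y) :=
  [/\ injective k, forall V : set X, open V -> open (k @` V) &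
      forall x, bijective (stalk_map (erefl (k x)))].

Definition embedding (X Y : topologicalType) (f : X -> Y) :=
  injective f /\
  forall V : set X, open V <-> exists2 W : set Y, open W & V = f @^-1` W.

Definition closed_immersion X Y (i : morphism X Y) :=
  [/\ embedding i, closed (range i) &
      forall x a, exists b, stalk_map (erefl (i x)) b = a].

Definition immersion X Y (i : morphism X Y) :=
  [/\ embedding i,
      exists V Z : set Y, [/\ open V, closed Z & range i = V `&` Z] &
      forall x a, exists b, stalk_map (erefl (i x)) b = a].

Definition scheme X :=
  forall x : X, exists Y (k : morphism Y X) (y : Y),
    [/\ affine Y, open_immersion k & k y = x].

Definition finite_type X :=
  exists m (Y : 'I_m -> ringedSpace K) (k : forall i, morphism (Y i) X),
    (forall i, [/\ affine (Y i), open_immersion (k i) &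
       finitely_generated_algebra (@str _ (Y i) (opensT (Y i)))]) /\
    (forall x : X, exists i (y : Y i), k i y = x).

Definition variety X := scheme X /\ finite_type X.

Definition cohen_macaulay X :=
  forall x : X, cohen_macaulay_local_ring (stalk x).

Definition reduced X :=
  forall (U : opens X) (s : sect U), (exists m, s ^+ m = 0) -> s = 0.

Definition irreducible X :=
  [set: X] !=set0 /\
  forall A B : set X, closed A -> closed B -> A `|` B = setT ->
    A = setT \/ B = setT.

(* Smooth of pure dimension d.  Smoothness is expressed by the regularity of
   the local rings, which is the right notion over a perfect field K. *)
Definition smooth d X :=
  [/\ variety X, forall x : X, exists e, regular_local_ring (stalk x) e &
      forall x : X, closed [set x] -> regular_local_ring (stalk x) d].

Definition smooth_irreducible_curve C := smooth 1 C /\ irreducible C.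

Definition smooth_surface S := smooth 2 S.

(* j is the inclusion of C = X_red: the reduced closed subscheme of X with the
   same underlying space *)
Definition reduced_subscheme C X (j : morphism C X) :=
  [/\ closed_immersion j, range j = setT & reduced C].

(* For an immersion i : U -> S of an open neighbourhood k : U -> X of P, and
   j : C -> X as above, the ideals of U and of C in the local ring of S at P *)
Definition ideal_of_neighbourhood U S (i : morphism U S) (p : U) :
    set (stalk (i p)) :=
  [set f | stalk_map (erefl (i p)) f = 0].

Definition ideal_of_curve X C U S (j : morphism C X) (k : morphism U X)
    (i : morphism U S) (P : X) (c : C) (p : U) (jc : j c = P) (kp : k p = P) :
    set (stalk (i p)) :=
  [set f | exists a : stalk P,
     stalk_map kp a = stalk_map (erefl (i p)) f /\ stalk_map jc a = 0].

Arguments ideal_of_neighbourhood {U S} i p _.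
Arguments ideal_of_curve {X C U S j k} i {P c p} jc kp _.

(* C being a smooth curve in a smooth surface, its ideal at P is always
   principal, so that the last condition is never vacuous. *)
Definition primitive_multiple_curve (n : nat) X :=
  [/\ variety X, cohen_macaulay X &
    exists C (j : morphism C X),
    [/\ reduced_subscheme j, smooth_irreducible_curve C &
      forall P : X, closed [set P] ->
      exists U S (k : morphism U X) (i : morphism U S) (p : U) (kp : k p = P),
      [/\ open_immersion k, smooth_surface S, immersion i &
        forall (c : C) (jc : j c = P) (z : stalk (i p)),
          ideal_of_curve i jc kp = principal z ->
          ideal_of_neighbourhood i p = principal (z ^+ n)]]].

End Schemes.

Record modSheaf (K : comPzRingType) (X : ringedSpace K) := ModSheaf {
  msect : forall U : opens X, lmodType (sect U);
  mres : forall U V : opens X, V `<=` U -> {additive msect U -> msect V};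
  mresZ : forall (U V : opens X) (h : V `<=` U) a s,
    mres h (a *: s) = res h a *: mres h s;
  mres_id : forall (U : opens X) (h : U `<=` U) s, mres h s = s;
  mres_comp : forall (U V W : opens X) (h : V `<=` U) (h' : W `<=` V)
    (h'' : W `<=` U) s, mres h' (mres h s) = mres h'' s;
  mres_sheaf : sheaf_axiom (fun U V h => mres h : msect U -> msect V) }.

Arguments mres {K X m U V} h.

Section Modules.
Variables (K : comPzRingType) (X : ringedSpace K).
Implicit Types E F G : modSheaf X.

Definition structure_sheaf : modSheaf X.
Proof.
refine (@ModSheaf K X (fun U => (sect U)^o)
  (fun U V h => res h : {additive _ -> _}) _ _ _ _).
- by move=> U V h a s; rewrite /= rmorphM.
- exact: res_id.
- exact: res_comp.
- exact: res_sheaf.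
Defined.

Record modMorphism E F := ModMorphism {
  mmap : forall U : opens X, {linear msect E U -> msect F U};
  mmap_res : forall (U V : opens X) (h : V `<=` U) s,
    mmap V (mres h s) = mres h (mmap U s) }.

(* Exactness as sheaves: a section lies in the image when it does so locally *)
Definition in_image E F (f : modMorphism E F) (U : opens X) (t : msect F U) :=
  forall x, oset U x -> exists (V : opens X) (h : V `<=` U) (s : msect E V),
    oset V x /\ mmap f V s = mres h t.

Definition short_exact E F G (f : modMorphism E F) (g : modMorphism F G) :=
  [/\ forall (U : opens X) (s : msect E U), mmap f U s = 0 -> s = 0,
      forall (U : opens X) (t : msect F U), mmap g U t = 0 <-> in_image f t &
      forall (U : opens X) (r : msect G U), in_image g r].

(* The O_U-submodule sheaf of (F|U)^m whose sections over V are those satisfying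
   R V is locally finitely generated. *)
Definition locally_generated F m (U : opens X)
    (R : forall V : opens X, V `<=` U -> ('I_m -> msect F V) -> Prop) :=
  forall x, oset U x -> exists (V : opens X) (h : V `<=` U) r
      (g : 'I_r -> 'I_m -> msect F V),
    [/\ oset V x, forall l, R V h (g l) &
    forall (W : opens X) (hW : W `<=` V) (t : 'I_m -> msect F W),
      R W (subset_trans hW h) t ->
    forall y, oset W y -> exists (W' : opens X) (hW' : W' `<=` W)
        (c : 'I_r -> sect W'), oset W' y /\
      forall i, mres hW' (t i) =
        \sum_(l < r) c l *: mres (subset_trans hW' hW) (g l i)].

(* F is of finite type, and so is the sheaf of relations of every finite family
   of sections over an open set. *)
Definition coherent F :=
  @locally_generated F 1 (opensT X) (fun _ _ _ => True) /\
  forall (U : opens X) m (s : 'I_m -> msect F U),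
    @locally_generated structure_sheaf m U
      (fun V h c => \sum_(i < m) (c i : sect V) *: mres h (s i) = 0).

Record submodSheaf F := SubmodSheaf {
  sub_sect : forall U : opens X, set (msect F U);
  sub0 : forall U, sub_sect (0 : msect F U);
  subD : forall U (s t : msect F U), sub_sect s -> sub_sect t -> sub_sect (s + t);
  subZ : forall U a (s : msect F U), sub_sect s -> sub_sect (a *: s);
  sub_res : forall (U V : opens X) (h : V `<=` U) (s : msect F U),
    sub_sect s -> sub_sect (mres h s);
  sub_local : forall (U : opens X) (s : msect F U),
    (forall x, oset U x -> exists (V : opens X) (h : V `<=` U),
       oset V x /\ sub_sect (mres h s)) ->
    sub_sect s }.

(* The points where the stalk is nonzero *)
Definition support F (T : submodSheaf F) : set X :=
  [set x | exists (U : opens X) (s : msect F U), [/\ oset U x, sub_sect T s &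
     forall (V : opens X) (h : V `<=` U), oset V x -> mres h s <> 0]].

Definition torsion_free F :=
  forall T : submodSheaf F, finite_set (support T) ->
    forall (U : opens X) (s : msect F U), sub_sect T s -> s = 0.

End Modules.

(* The sheaf Hom(E, F): its sections over U are the morphisms E|U -> F|U *)

Section HomSheaf.
Variables (K : comPzRingType) (X : ringedSpace K) (E F : modSheaf X).

Record homSect (U : opens X) := HomSect {
  happ : forall V : opens X, V `<=` U -> {linear msect E V -> msect F V};
  happ_res : forall (V W : opens X) (hV : V `<=` U) (hW : W `<=` U)
    (h : W `<=` V) s, happ hW (mres h s) = mres h (happ hV s) }.

Lemma homSect_eq (U : opens X) (f g : homSect U) :
  (forall (V : opens X) (h : V `<=` U) s, happ f h s = happ g h s) -> f = g.
Proof.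
case: f g => [f fr] [g gr] /= fg.
have e : f = g.
  apply: functional_extensionality_dep => V.
  apply: functional_extensionality_dep => h.
  have: (f V h : _ -> _) = g V h by apply/funext => s; exact: fg.
  case: (f V h) (g V h) => [u [[c] [c']]] [v [[d] [d']]] /= uv.
  case: _ / uv in d d' *.
  by rewrite (Prop_irrelevance c d) (Prop_irrelevance c' d').
by case: _ / e gr {fg} => gr; congr HomSect; exact: Prop_irrelevance.
Qed.

HB.instance Definition _ U := gen_eqMixin (homSect U).
HB.instance Definition _ U := gen_choiceMixin (homSect U).

Section Operations.
Variable U : opens X.

Program Definition hom_zero : homSect U := @HomSect U (fun _ _ => \0) _.
Next Obligation. by move=> V W hV hW h s /=; rewrite raddf0. Qed.

Program Definition hom_add (f g : homSect U) : homSect U :=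
  @HomSect U (fun _ h => happ f h \+ happ g h) _.
Next Obligation.
by move=> f g V W hV hW h s /=; rewrite !(happ_res _ hV hW) raddfD.
Qed.

Program Definition hom_opp (f : homSect U) : homSect U :=
  @HomSect U (fun _ h => \- happ f h) _.
Next Obligation.
by move=> f V W hV hW h s /=; rewrite (happ_res _ hV hW) raddfN.
Qed.

Program Definition hom_scale (a : sect U) (f : homSect U) : homSect U :=
  @HomSect U (fun _ h => res h a \*: happ f h) _.
Next Obligation.
move=> a f V W hV hW h s /=.
by rewrite (happ_res _ hV hW) mresZ (res_comp _ _ hW).
Qed.

Lemma hom_addA : associative hom_add.
Proof. by move=> f g k; apply: homSect_eq => V h s /=; rewrite addrA. Qed.

Lemma hom_addC : commutative hom_add.
Proof. by move=> f g; apply: homSect_eq => V h s /=; rewrite addrC. Qed.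

Lemma hom_add0 : left_id hom_zero hom_add.
Proof. by move=> f; apply: homSect_eq => V h s /=; rewrite add0r. Qed.

Lemma hom_addN : left_inverse hom_zero hom_opp hom_add.
Proof. by move=> f; apply: homSect_eq => V h s /=; rewrite addNr. Qed.

HB.instance Definition _ :=
  GRing.isZmodule.Build (homSect U) hom_addA hom_addC hom_add0 hom_addN.

Lemma hom_scaleA a b f : hom_scale a (hom_scale b f) = hom_scale (a * b) f.
Proof. by apply: homSect_eq => V h s /=; rewrite scalerA rmorphM. Qed.

Lemma hom_scale1 : left_id 1 hom_scale.
Proof. by move=> f; apply: homSect_eq => V h s /=; rewrite rmorph1 scale1r. Qed.

Lemma hom_scaleDr : right_distributive hom_scale +%R.
Proof. by move=> a f g; apply: homSect_eq => V h s /=; rewrite scalerDr. Qed.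

Lemma hom_scaleDl f : {morph hom_scale^~ f : a b / a + b}.
Proof. by move=> a b; apply: homSect_eq => V h s /=; rewrite rmorphD scalerDl. Qed.

HB.instance Definition _ :=
  GRing.Zmodule_isLmodule.Build (sect U) (homSect U)
    hom_scaleA hom_scale1 hom_scaleDr hom_scaleDl.

End Operations.

Definition hom_res (U V : opens X) (h : V `<=` U) (f : homSect U) : homSect V :=
  @HomSect V (fun W hW => happ f (subset_trans hW h))
    (fun W W' hW hW' => happ_res f (subset_trans hW h) (subset_trans hW' h)).

Lemma hom_res_is_zmod_morphism (U V : opens X) (h : V `<=` U) :
  zmod_morphism (hom_res h).
Proof. by move=> f g; apply: homSect_eq. Qed.

HB.instance Definition _ (U V : opens X) (h : V `<=` U) :=
  GRing.isZmodMorphism.Build (homSect U) (homSect V) (hom_res h)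
    (hom_res_is_zmod_morphism h).

Lemma happ_irr (U V : opens X) (f : homSect U) (h h' : V `<=` U) s :
  happ f h s = happ f h' s.
Proof. by rewrite (Prop_irrelevance h h'). Qed.

Section Gluing.
Variables (U : opens X) (I : Type) (V : I -> opens X).
Variables (hV : forall i, V i `<=` U) (f : forall i, homSect (V i)).
Hypothesis cover : U `<=` \bigcup_i V i.
Hypothesis compat : forall i j (W : opens X) (hi : W `<=` V i)
  (hj : W `<=` V j), hom_res hi (f i) = hom_res hj (f j).

Lemma mres_separated (W : opens X) (s t : msect F W) : W `<=` U ->
  (forall i, mres (@opensIl _ W (V i)) s = mres (@opensIl _ W (V i)) t) ->
  s = t.
Proof.
move=> hW st.
have [||r [_ ru]] := @mres_sheaf _ _ F W I (fun i => opensI W (V i))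
  (fun i => @opensIl _ W (V i)) (fun i => mres (@opensIl _ W (V i)) s).
- by move=> x Wx; have [i _ Vx] := cover (hW x Wx); exists i.
- move=> i j W' hi hj; rewrite (mres_comp _ _ (subset_trans hi (@opensIl _ _ _))).
  by rewrite (mres_comp _ _ (subset_trans hi (@opensIl _ _ _))).
by rewrite -(ru s)// -(ru t)// => i; rewrite st.
Qed.

Lemma glue_exists (W : opens X) (hW : W `<=` U) (s : msect E W) :
  exists t : msect F W, forall i (W' : opens X) (h : W' `<=` W)
    (h' : W' `<=` V i), mres h t = happ (f i) h' (mres h s).
Proof.
have [||t [tP _]] := @mres_sheaf _ _ F W I (fun i => opensI W (V i))
  (fun i => @opensIl _ W (V i))
  (fun i => happ (f i) (@opensIr _ W (V i)) (mres (@opensIl _ W (V i)) s)).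
- by move=> x Wx; have [i _ Vx] := cover (hW x Wx); exists i.
- move=> i j W' hi hj.
  have hi' := subset_trans hi (@opensIr _ _ _).
  have hj' := subset_trans hj (@opensIr _ _ _).
  rewrite -(happ_res (f i) _ hi') -(happ_res (f j) _ hj').
  rewrite !(mres_comp _ _ (subset_trans hi (@opensIl _ _ _))).
  have := congr1 (fun g => happ g (@subset_refl _ W')
    (mres (subset_trans hi (@opensIl _ _ _)) s)) (compat hi' hj').
  rewrite /= (happ_irr _ _ hi') => ->.
  exact: happ_irr.
exists t => i W' h h'.
have k : W' `<=` opensI W (V i) by move=> x W'x; split; [exact: h|exact: h'].
rewrite -(mres_comp (@opensIl _ _ _) k) tP -(happ_res (f i) _ h').
by rewrite (mres_comp _ _ h).
Qed.

Definition glue_fun (W : opens X) (hW : W `<=` U) (s : msect E W) : msect F W :=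
  sval (cid (glue_exists hW s)).

Lemma glue_funE (W : opens X) (hW : W `<=` U) (s : msect E W) i
    (W' : opens X) (h : W' `<=` W) (h' : W' `<=` V i) :
  mres h (glue_fun hW s) = happ (f i) h' (mres h s).
Proof. by rewrite /glue_fun; case: cid => t /= tP; exact: tP. Qed.

Lemma glue_fun_semilinear (W : opens X) (hW : W `<=` U) :
  semilinear (glue_fun hW).
Proof.
split=> [a s|s t]; apply: (mres_separated hW) => i.
  by rewrite mresZ !(glue_funE _ _ _ (@opensIr _ _ _)) mresZ linearZ.
by rewrite raddfD !(glue_funE _ _ _ (@opensIr _ _ _)) !raddfD.
Qed.

HB.instance Definition _ (W : opens X) (hW : W `<=` U) :=
  GRing.isSemilinear.Build (sect W) (msect E W) (msect F W) *:%R
    (glue_fun hW) (glue_fun_semilinear hW).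

Lemma glue_fun_res (W W' : opens X) (hW : W `<=` U) (hW' : W' `<=` U)
    (h : W' `<=` W) s : glue_fun hW' (mres h s) = mres h (glue_fun hW s).
Proof.
apply: (mres_separated hW') => i.
rewrite (glue_funE _ _ _ (@opensIr _ _ _)).
rewrite !(mres_comp _ _ (subset_trans (@opensIl _ _ _) h)).
by rewrite (glue_funE _ _ _ (@opensIr _ _ _)).
Qed.

Definition glue : homSect U :=
  @HomSect U (fun W hW => glue_fun hW : {linear _ -> _}) glue_fun_res.

End Gluing.

Lemma hom_sheaf : sheaf_axiom hom_res.
Proof.
move=> U I V hV f cover compat; exists (glue cover compat); split.
  move=> i; apply: homSect_eq => W hW s /=.
  rewrite -[LHS](mres_id (@subset_refl _ _)) (glue_funE cover compat _ _ _ hW).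
  by rewrite mres_id.
move=> g gP; apply: homSect_eq => W hW s /=.
apply: (mres_separated cover hW) => i.
rewrite (glue_funE cover compat _ _ _ (@opensIr _ _ _)) -gP /=.
have hi : opensI W (V i) `<=` U := subset_trans (@opensIl _ _ _) hW.
by rewrite -(happ_res g hW hi); exact: happ_irr.
Qed.

Definition Hom : modSheaf X.
Proof.
refine (@ModSheaf K X (fun U => homSect U)
  (fun U V h => hom_res h : {additive _ -> _}) _ _ _ _).
- move=> U V h a f; apply: homSect_eq => W hW s /=.
  by rewrite (res_comp _ _ (subset_trans hW h)).
- by move=> U h f; apply: homSect_eq => W hW s /=; exact: happ_irr.
- by move=> U V W h h' h'' f; apply: homSect_eq => W' hW s /=; exact: happ_irr.
- exact: hom_sheaf.
Defined.

End HomSheaf.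

Section Dual.
Variables (K : comPzRingType) (X : ringedSpace K).

Section Pullback.
Variables (E F G : modSheaf X) (f : modMorphism E F).

Definition hom_comp (U : opens X) (phi : homSect F G U) : homSect E G U.
Proof.
refine (@HomSect _ _ E G U
  (fun V h => happ phi h \o mmap f V : {linear _ -> _}) _).
by move=> V W hV hW h s; rewrite /= mmap_res (happ_res _ hV hW).
Defined.

Lemma hom_comp_semilinear (U : opens X) : semilinear (@hom_comp U).
Proof. by split=> [a u|u v]; apply: homSect_eq. Qed.

HB.instance Definition _ (U : opens X) :=
  GRing.isSemilinear.Build (sect U) (homSect F G U) (homSect E G U) *:%R
    (@hom_comp U) (@hom_comp_semilinear U).

Definition Hom_map : modMorphism (Hom F G) (Hom E G).
Proof.
refine (@ModMorphism _ _ (Hom F G) (Hom E G)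
  (fun U => @hom_comp U : {linear homSect F G U -> homSect E G U}) _).
by move=> U V h phi; apply: homSect_eq.
Defined.

End Pullback.

Definition dual (E : modSheaf X) : modSheaf X := Hom E (structure_sheaf X).

Definition dual_map (E F : modSheaf X) (f : modMorphism E F) :
    modMorphism (dual F) (dual E) :=
  Hom_map (structure_sheaf X) f.

End Dual.

(* Main.v *)
From HB Require Import structures.
Require Import Defs.
From mathcomp Require Import all_boot all_order all_algebra.
From mathcomp Require Import all_classical all_reals all_analysis.
From mathcomp Require Import complex.
From mathcomp Require Import ring.

Set Implicit Arguments.
Unset Strict Implicit.
Unset Printing Implicit Defensive.

Import GRing.Theory.
Local Open Scope classical_set_scope.
Local Open Scope ring_scope.

(* Left exactness of Hom(-, O) is formal.  For the surjectivity, let x be a point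
   and A the local ring of X at x.  If x is closed, A is a quotient of a regular
   local ring of dimension 2, its maximal ideal is (t, z) with z nilpotent and
   A/(z) a discrete valuation ring; as A is Cohen-Macaulay of dimension 1, the
   annihilator of z^N is (z), where z^N is the last nonzero power of z.  At the
   generic point the same holds with A/(z) a field.

   A linear map from E_x to A extends to F_x when F_x/E_x is torsion free: one
   adjoins elements e with z e in the domain, and the value at e is a solution y
   of z y = phi(z e), which exists because z^N kills phi(z e).  Coherence lets one
   replace F_x by A^r modulo finitely many relations, so that the extension spreads
   out to a neighbourhood of x.

   The torsion freeness of the sheaf G gives that of G_x because an element of A
   outside (z) is invertible on a punctured neighbourhood of x, which uses that
   closed points are cut out by finitely many functions (Hilbert's basis theorem). *)

(** * Noetherian rings and Hilbert's basis theorem *)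

(** The curve and the surface are described only at closed points, while exactness of sheaves is
    tested at every point of the scheme. Each point is therefore compared with a closed
    specialization, of whose local ring its own is a localization. Closed specializations, and
    finite systems of equations for closed points, are found in affine charts whose rings of
    sections must be noetherian. The noetherian stalks contained in the Cohen-Macaulay hypothesis do
    not give this, so it is derived from finite type. The extension of linear maps uses neither Ext
    nor injective hulls. Finding a value at the adjoined element e is easy; the obstacle is that the
    enlarged domain must again have a torsion free cokernel, or the process stops. Taking e with M +
    Ae as large as possible, M being the old domain, overcomes it, because divisibility in A/(z) is
    a total preorder. *)

Definition max_condition T (F : set (set T)) :=
  forall G : set (set T), G `<=` F -> G !=set0 ->
    exists M, G M /\ forall M', G M' -> M `<=` M' -> M' `<=` M.

Section RelativeModules.
Variables (B : comPzRingType) (S : set B).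

Definition submod_over (V : lmodType B) (M : set V) :=
  [/\ M 0, forall u v, M u -> M v -> M (u + v)
    & forall s v, S s -> M v -> M (s *: v)].

(** The members of this family are the ideals of [S]. Subrings are kept as subsets of a fixed [B],
    so that generators can be adjoined one at a time with neither polynomial rings nor quotients. *)
Definition noetherian_subring :=
  max_condition [set M : set B^o | submod_over M /\ M `<=` S].

Hypothesis Sring : subring S.

Lemma subring1 : S 1. Proof. by case: Sring. Qed.

Lemma subring0 : S 0.
Proof. by case: Sring => S1 SB _; rewrite -(subrr 1); exact: SB. Qed.

Lemma subringN a : S a -> S (- a).
Proof. by case: Sring => _ SB _ Sa; rewrite -sub0r; apply: SB => //; exact: subring0. Qed.

Lemma subringD a b : S a -> S b -> S (a + b).
Proof.
by move=> Sa Sb; case: Sring => _ SB _; rewrite -(opprK b); apply: SB => //; exact: subringN.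
Qed.

Lemma subringM a b : S a -> S b -> S (a * b).
Proof. by case: Sring => _ _; exact. Qed.

Lemma submod_overB (V : lmodType B) (M : set V) u v :
  submod_over M -> M u -> M v -> M (u - v).
Proof.
case=> _ MD MZ Mu Mv; apply: MD => //; rewrite -scaleN1r; apply: MZ => //.
exact/subringN/subring1.
Qed.

(** Induction on the number [k] of coordinates allowed to be nonzero: for nested submodules, equal
    images [J] under the last coordinate and equal intersections with [Z k] force equality. *)
Lemma noetherian_subring_rV r : noetherian_subring ->
  max_condition [set M : set 'rV[B]_r |
    submod_over M /\ forall v, M v -> forall i, S (v 0 i)].
Proof.
move=> noethS.
pose Z k := [set v : 'rV[B]_r | forall i : 'I_r, (k <= i)%N -> v 0 i = 0].
have maxZ k : (k <= r)%N -> max_condition [set M : set 'rV[B]_r |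
    [/\ submod_over M, M `<=` Z k & forall v, M v -> forall i, S (v 0 i)]].
  elim: k => [_|k IH kr] G GF [M0 GM0].
    exists M0; split=> // M' GM' _ v M'v.
    have [_ /(_ v M'v) Zv _] := GF _ GM'.
    suff -> : v = 0 by have [[]] := GF _ GM0.
    by apply/rowP => i; rewrite Zv// mxE.
  pose K := Ordinal kr.
  pose J (M : set 'rV[B]_r) : set B^o := [set a | exists2 v, M v & v 0 K = a].
  have JP M : G M -> submod_over (J M) /\ J M `<=` S.
    move=> /GF[[M0' MD MZ] _ MS]; split; last by move=> a [v Mv <-]; exact: MS.
    split=> [|u v [u' Mu <-] [v' Mv <-]|s v Ss [v' Mv <-]].
    - by exists 0; rewrite ?mxE.
    - by exists (u' + v'); rewrite ?mxE//; exact: MD.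
    - by exists (s *: v'); rewrite ?mxE//; exact: MZ.
  have [||_ [[M1 GM1 <-] M1max]] := noethS (J @` G).
  - by move=> _ [M GM <-]; exact: JP.
  - by exists (J M0), M0.
  (* Only modules with image at least [J M1] compete. Their images all equal [J M1], so only the
     kernel of the last coordinate is left to maximize. *)
  pose G' := [set N | exists M, [/\ G M, J M1 `<=` J M & N = M `&` Z k]].
  have [|||N [[M2 [GM2 J12 ->]] M2max]] := IH _ G'.
  - exact: ltnW.
  - move=> _ [M [GM JM ->]]; have [[MO MD MZ] _ MS] := GF _ GM.
    split; [split|by move=> v []|by move=> v [Mv _]; exact: MS].
    + by split=> // i _; rewrite mxE.
    + by move=> u v [Mu Zu] [Mv Zv]; split; [exact: MD|move=> i ki; rewrite mxE Zu// Zv// addr0].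
    + by move=> s v Ss [Mv Zv]; split; [exact: MZ|move=> i ki; rewrite mxE Zv// mulr0].
  - by exists (M1 `&` Z k), M1; split.
  exists M2; split=> // M' GM' M2M' v M'v.
  have JM2M' : J M2 `<=` J M' by move=> a [w M2w <-]; exists w => //; exact: M2M'.
  have : J M1 (v 0 K).
    apply: (M1max (J M')); [by exists M'|exact: subset_trans J12 JM2M'|by exists v].
  move=> /J12[w M2w wv].
  have [M2mod _ _] := GF _ GM2; have [M'mod M'Z _] := GF _ GM'.
  suff : M2 (v - w).
    by move=> M2vw; rewrite -(subrK w v); case: M2mod => _ MD _; exact: MD.
  have M'vw : M' (v - w) by apply: submod_overB => //; exact: M2M'.
  suff [] : (M2 `&` Z k) (v - w) by [].
  apply: (M2max (M' `&` Z k)).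
  - by exists M'; split=> //; exact: subset_trans JM2M'.
  - by move=> u [M2u Zu]; split=> //; exact: M2M'.
  - split=> // i; rewrite leq_eqVlt => /orP[/eqP ki|ki].
      by rewrite (_ : i = K) ?mxE ?wv ?subrr//; exact/val_inj/esym.
    exact: M'Z.
move=> G GF G0; apply: (maxZ r) => // M /GF[Mmod MS]; split=> // v Mv i.
by rewrite leqNgt ltn_ord.
Qed.

Variable b : B.

Definition adjoin : set B :=
  [set x | exists d (c : nat -> B), (forall i, S (c i)) /\
     x = \sum_(i < d) c i * b ^+ i].

Lemma adjoin_sub : S `<=` adjoin.
Proof.
move=> s Ss; exists 1%N, (fun=> s); split=> //.
by rewrite big_ord1 expr0 mulr1.
Qed.

Lemma adjoinD x y : adjoin x -> adjoin y -> adjoin (x + y).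
Proof.
have pad d d' (c : nat -> B) : (d <= d')%N ->
    \sum_(i < d) c i * b ^+ i = \sum_(i < d') (if (i < d)%N then c i else 0) * b ^+ i.
  move=> dd'; rewrite (big_ord_widen _ (fun i => c i * b ^+ i) dd') big_mkcond.
  by apply: eq_bigr => i _; case: ifP; rewrite ?mul0r.
move=> [d [c [Sc ->]]] [d' [c' [Sc' ->]]].
rewrite (pad _ _ _ (leq_maxl d d')) (pad _ _ _ (leq_maxr d d')).
exists (maxn d d'), (fun i => (if (i < d)%N then c i else 0) +
  (if (i < d')%N then c' i else 0)); split.
  by move=> i; apply: subringD; case: ifP => // _; exact: subring0.
by rewrite -big_split; apply: eq_bigr => i _; rewrite mulrDl.
Qed.

Lemma adjoinZ s x : S s -> adjoin x -> adjoin (s * x).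
Proof.
move=> Ss [d [c [Sc ->]]]; exists d, (fun i => s * c i); split.
  by move=> i; exact: subringM.
by rewrite mulr_sumr; apply: eq_bigr => i _; rewrite mulrA.
Qed.

Lemma adjoinX x : adjoin x -> adjoin (b * x).
Proof.
move=> [d [c [Sc ->]]]; exists d.+1, (fun i => if i is j.+1 then c j else 0).
split; first by case=> // ; exact: subring0.
rewrite big_ord_recl mul0r add0r mulr_sumr; apply: eq_bigr => i _.
by rewrite /= exprS mulrCA.
Qed.

Lemma adjoin_gen : adjoin b.
Proof. by rewrite -[b]mulr1; apply/adjoinX/adjoin_sub/subring1. Qed.

Lemma adjoin_subring : subring adjoin.
Proof.
have Xn i x : adjoin x -> adjoin (b ^+ i * x).
  by move=> ax; elim: i => [|i IH]; rewrite ?expr0 ?mul1r// exprS -mulrA; exact: adjoinX.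
split=> [|x y ax ay|x y ax [d [c [Sc ->]]]].
- exact/adjoin_sub/subring1.
- apply: adjoinD => //; rewrite -mulN1r; apply: adjoinZ => //.
  exact/subringN/subring1.
- rewrite mulr_sumr; apply: (big_ind adjoin).
  + exact/adjoin_sub/subring0.
  + exact: adjoinD.
  + by move=> i _; rewrite mulrCA; apply: adjoinZ => //; rewrite mulrC; exact: Xn.
Qed.

End RelativeModules.

(* Hilbert's basis theorem.  For an ideal I of S[b], [L d I] is the ideal of
   leading coefficients of elements of I of degree d, and [Mo d I] the module of
   elements of I of degree < d; I is determined by [Mo D I] and [L d I], d >= D. *)
Lemma noetherian_adjoin (B : comPzRingType) (S : set B) (b : B) :
  subring S -> noetherian_subring S -> noetherian_subring (adjoin S b).
Proof.
move=> Sring noethS G GF [I0 GI0].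
pose ev d (c : 'rV[B]_d) := \sum_(i < d) c 0 i * b ^+ i.
have evD d (c c' : 'rV[B]_d) : ev d (c + c') = ev d c + ev d c'.
  by rewrite -big_split; apply: eq_bigr => i _; rewrite mxE mulrDl.
have evZ d a (c : 'rV[B]_d) : ev d (a *: c) = a * ev d c.
  by rewrite mulr_sumr; apply: eq_bigr => i _; rewrite mxE mulrA.
have ev0 d : ev d 0 = 0 by rewrite /ev big1// => i _; rewrite mxE mul0r.
pose Mo d (I : set B^o) := [set c : 'rV[B]_d | (forall i, S (c 0 i)) /\ I (ev d c)].
pose L d (I : set B^o) : set B^o :=
  [set a | exists2 c : 'rV[B]_d.+1, Mo d.+1 I c & c 0 ord_max = a].
have GS I a v : G I -> S a -> I v -> I (a * v).
  move=> /GF[[_ _ IZ] _] Sa Iv; apply: (IZ a v) => //; exact: adjoin_sub.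
have GX I v : G I -> I v -> I (b * v).
  move=> /GF[[_ _ IZ] _] Iv; apply: (IZ b v) => //; exact: (adjoin_gen Sring).
have GXn I v i : G I -> I v -> I (b ^+ i * v).
  by move=> GI Iv; elim: i => [|i IH]; rewrite ?expr0 ?mul1r// exprS -mulrA; exact: GX.
have GD I u v : G I -> I u -> I v -> I (u + v) by move=> /GF[[_ ID _] _]; exact: ID.
have GB I u v : G I -> I u -> I v -> I (u - v).
  move=> GI Iu Iv; have [Imod _] := GF _ GI.
  exact: (@submod_overB _ _ (adjoin_subring Sring b) B^o I u v Imod Iu Iv).
have G0 I : G I -> I 0 by move=> /GF[[]].
have MoP d I : G I -> submod_over S (Mo d I) /\ forall v, Mo d I v -> forall i, S (v 0 i).
  move=> GI; split; last by move=> v [].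
  split=> [|u v [Su Iu] [Sv Iv]|s v Ss [Sv Iv]].
  - by split=> [i|]; [rewrite mxE; exact: (subring0 Sring)|rewrite ev0; exact: G0].
  - by split=> [i|]; [rewrite mxE; exact: (subringD Sring)|rewrite evD; exact: GD].
  - by split=> [i|]; [rewrite mxE; exact: (subringM Sring)|rewrite evZ; exact: GS].
have LP d I : G I -> submod_over S (L d I) /\ L d I `<=` S.
  move=> GI; have [[M0 MD MZ] MS] := MoP d.+1 I GI.
  split; last by move=> a [v /MS Mv <-].
  split=> [|_ _ [u' Mu <-] [v' Mv <-]|s _ Ss [v' Mv <-]].
  - by exists 0; rewrite ?mxE.
  - by exists (u' + v'); rewrite ?mxE//; exact: MD.
  - by exists (s *: v'); rewrite ?mxE//; exact: MZ.
(* Multiplication by [b] shifts the coefficients by one and keeps the leading one. *)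
have LS d I : G I -> L d I `<=` L d.+1 I.
  move=> GI a [c [Sc Ic] <-].
  exists (\row_i if unlift ord0 i is Some j then c 0 j else 0).
    split=> [i|]; first by rewrite mxE; case: unlift => [j|]; [exact: Sc|exact: (subring0 Sring)].
    rewrite /ev big_ord_recl mxE unlift_none mul0r add0r.
    rewrite (_ : \sum_(i < _) _ = b * ev d.+1 c); first exact: (GX _ _ GI Ic).
    rewrite mulr_sumr; apply: eq_bigr => i _.
    by rewrite mxE liftK exprS mulrCA.
  rewrite mxE (_ : ord_max = lift ord0 ord_max) ?liftK//; exact: val_inj.
have Lle d d' I : G I -> (d <= d')%N -> L d I `<=` L d' I.
  move=> GI; elim: d' => [|d' IH]; first by rewrite leqn0 => /eqP ->.
  rewrite leq_eqVlt => /orP[/eqP -> //|]; rewrite ltnS => /IH H.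
  exact: subset_trans (LS _ _ GI).
have Lsub d I I' : I `<=` I' -> L d I `<=` L d I'.
  by move=> II' a [c [Sc Ic] <-]; exists c => //; split=> //; exact: II'.
(* Degree and ideal are maximized together, so no [L d I] with [d >= D] and [I] containing [I1] is
   larger than [L D I1]. *)
have [||_ [[[D I1] /= GI1 <-] Lmax]] :=
  noethS [set J | exists2 p : nat * set B^o, G p.2 & L p.1 p.2 = J].
- by move=> _ [[d I] /= GI <-]; exact: LP.
- by exists (L 0%N I0), (0%N, I0).
have [||_ [[I2 [GI2 I12] <-] Momax]] := @noetherian_subring_rV _ _ Sring D noethS
  (Mo D @` [set I | G I /\ I1 `<=` I]).
- by move=> _ [I [GI _] <-]; exact: MoP.
- by exists (Mo D I1), I1 => //; split.
exists I2; split=> // I GI I2I v Iv.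
have [_ /(_ v Iv) [d [c [Sc vE]]]] := GF _ GI.
(* The induction is on the number of coefficients in a chosen expression of [v]: the powers of [b]
   may satisfy relations, so [v] has no degree of its own. *)
elim: d => [|d IHd] in c Sc v vE Iv *.
  by rewrite vE big_ord0; exact: G0.
have [dD|Dd] := leqP d.+1 D.
  have MoI : Mo D I `<=` Mo D I2.
    apply: Momax; first by exists I => //; split=> //; exact: subset_trans I2I.
    by move=> e [Se Ie]; split=> //; exact: I2I.
  pose e : 'rV[B]_D := \row_i if (i < d.+1)%N then c i else 0.
  have eE : ev D e = v.
    rewrite vE (big_ord_widen _ (fun i => c i * b ^+ i) dD) big_mkcond.
    by apply: eq_bigr => i _; rewrite mxE; case: ifP; rewrite ?mul0r.
  rewrite -eE; suff [] : Mo D I2 e by [].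
  apply: MoI; split=> [i|]; last by rewrite eE.
  by rewrite mxE; case: ifP => // _; exact: (subring0 Sring).
have : L D I1 (c d).
  apply: (Lmax (L d I)); first by exists (d, I).
    apply: (subset_trans (Lsub D _ _ (subset_trans I12 I2I))); exact: Lle.
  exists (\row_i c i); last by rewrite mxE.
  split=> [i|]; first by rewrite mxE.
  rewrite (_ : ev _ _ = v)// vE; apply: eq_bigr => i _; by rewrite mxE.
move=> [e [Se I1e] ce].
(* [w] lies in [I2] and has the same top coefficient as [v], so [v - w] has an expression with one
   coefficient fewer; [e'] omits the cancelled top term of [e]. *)
pose w := b ^+ (d - D) * ev D.+1 e.
have I2w : I2 w by apply: GXn => //; exact: I12.
rewrite -(subrK w v); apply: GD => //.
pose e' i := if (i < D)%N then e 0 (inord i) else 0.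
pose s i := c i - (if (d - D <= i)%N then e' (i - (d - D))%N else 0).
apply: (IHd s).
- move=> i; rewrite /s; have [_ SB _] := Sring; apply: SB => //.
  case: ifP => _; last exact: (subring0 Sring).
  by rewrite /e'; case: ifP => _ //; exact: (subring0 Sring).
- rewrite vE /w /ev big_ord_recr /= [X in _ - _ * X]big_ord_recr /= ce mulrDr.
  rewrite [b ^+ (d - D) * (c d * _)]mulrCA -exprD subnK//.
  rewrite opprD addrACA [c d * _ - _]subrr addr0.
  rewrite [RHS](eq_bigr (fun i : 'I_d => c i * b ^+ i -
     (if (d - D <= i)%N then e' (i - (d - D))%N else 0) * b ^+ i)); last first.
    by move=> i _; rewrite mulrBl.
  rewrite sumrB; congr (_ - _).
  rewrite -(big_mkord xpredT (fun i => (if (d - D <= i)%N then e' (i - (d - D))%N else 0) * b ^+ i)).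
  rewrite (big_cat_nat (n := (d - D)%N)) ?leq_subr//=.
  rewrite [X in X + _]big_nat_cond [X in X + _]big1 => [|i /andP[/andP[_ id] _]]; last first.
    by rewrite leqNgt id mul0r.
  rewrite add0r -[X in \sum_(X <= _ < _) _]add0n big_addn subKn// big_mkord mulr_sumr.
  apply: eq_bigr => i _; rewrite leq_addl addnK /e' ltn_ord.
  rewrite mulrCA -exprD addnC; congr (e 0 _ * _); apply: val_inj.
  by rewrite /= inordK// ltnS ltnW.
- by apply: GB => //; exact: I2I.
Qed.

Section Noetherian.
Variable A : comPzRingType.
Implicit Types (a b x : A) (I : set A).

Lemma subringT : subring [set: A].
Proof. by []. Qed.

Definition max_noetherian := @noetherian_subring A setT.

Lemma noeth_max (G : set (set A)) : max_noetherian -> (forall I, G I -> is_ideal I) ->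
  G !=set0 -> exists M, G M /\ forall M', G M' -> M `<=` M' -> M' = M.
Proof.
move=> noethA Gid G0; have [|//|M [GM Mmax]] := noethA G.
  by move=> I /Gid[I0 ID IM]; split=> //; split=> // s v _; exact: IM.
by exists M; split=> // M' GM' MM'; apply/seteqP; split=> //; exact: Mmax.
Qed.

Lemma is_ideal_generated m (g : 'I_m -> A) : is_ideal (generated g).
Proof.
split.
- by exists (fun=> 0); rewrite big1// => i _; rewrite mul0r.
- move=> _ _ [c ->] [d ->]; exists (fun i => c i + d i); rewrite -big_split.
  by apply: eq_bigr => i _; rewrite mulrDl.
- move=> a _ [c ->]; exists (fun i => a * c i); rewrite mulr_sumr.
  by apply: eq_bigr => i _; rewrite mulrA.
Qed.

Lemma ideal_sum I m (F : 'I_m -> A) : is_ideal I -> (forall i, I (F i)) ->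
  I (\sum_(i < m) F i).
Proof. by case=> I0 ID _ IF; apply: (big_ind I). Qed.

Lemma generated_sub m (g : 'I_m -> A) I : is_ideal I -> (forall i, I (g i)) ->
  generated g `<=` I.
Proof.
move=> Iid Ig _ [c ->]; apply: ideal_sum => // i.
by case: Iid => _ _; exact.
Qed.

Lemma generated_gen m (g : 'I_m -> A) i : generated g (g i).
Proof.
exists (fun j => if j == i then 1 else 0).
rewrite (bigD1 i)//= eqxx mul1r big1 ?addr0// => j /negbTE ->.
by rewrite mul0r.
Qed.

(** Adjoining any element of [I] to a maximal finitely generated subideal gives nothing larger. *)
Lemma noeth_fg I : max_noetherian -> is_ideal I ->
  exists m (g : 'I_m -> A), I = generated g.
Proof.
move=> noethA Iid.
have [||_ [[m [g [Ig <-]]] gmax]] := @noeth_max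
  [set J | exists m (g : 'I_m -> A), (forall i, I (g i)) /\ generated g = J] noethA.
- by move=> _ [m [g [_ <-]]]; exact: is_ideal_generated.
- by exists (generated (fun _ : 'I_0 => 0 : A)), 0%N, (fun=> 0); split=> // -[].
exists m, g; apply/seteqP; split; last exact: generated_sub.
move=> a Ia.
pose h i := if unlift ord0 i is Some j then g j else a : A.
have <- : generated h = generated g.
  apply: gmax; first by exists m.+1, h; split=> // i; rewrite /h; case: unlift.
  apply: generated_sub; first exact: is_ideal_generated.
  by move=> i; have := generated_gen h (lift ord0 i); rewrite {2}/h liftK.
by have := generated_gen h ord0; rewrite {2}/h unlift_none.
Qed.

(** Zorn's lemma on [G]: the union of a nonempty chain is an ideal whose finitely many generators
    already lie in one member, which therefore bounds the chain. *)
Lemma noetherian_noeth : noetherian A -> max_noetherian.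
Proof.
move=> noethA G GF [I0 GI0].
have GI I : G I -> is_ideal I.
  by move=> /GF[[I1 I2 I3] _]; split=> // a b; exact: I3.
pose T := {I : set A | G I}.
pose R (I J : T) := `[< sval I `<=` sval J >].
have [||||[M GM] Mmax] := @Zorn T R.
- by move=> I; apply/asboolP.
- move=> I J K /asboolP IJ /asboolP JK; apply/asboolP; exact: subset_trans JK.
- move=> [I hI] [J hJ] /asboolP/= IJ /asboolP/= JI; apply: eq_exist; exact/seteqP.
- move=> C Ctot'; have Ctot J K : C J -> C K -> sval J `<=` sval K \/ sval K `<=` sval J.
    by move=> CJ CK; have [/asboolP|/asboolP] := Ctot' J K CJ CK; [left|right].
  have [C0|/set0P[J0 CJ0]] := eqVneq C set0.
    by exists (exist _ _ GI0) => s; rewrite C0.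
  have [|m [g gE]] := noethA [set a | exists2 J, C J & sval J a].
    split=> [|a b [J CJ Ja] [K CK Kb]|a b [J CJ Jb]].
    - by exists J0 => //; have [] := GI _ (svalP J0).
    - have [JK|KJ] := Ctot J K CJ CK.
        by exists K => //; have [_ KD _] := GI _ (svalP K); apply: KD => //; exact: JK.
      by exists J => //; have [_ KD _] := GI _ (svalP J); apply: KD => //; exact: KJ.
    - by exists J => //; have [_ _] := GI _ (svalP J); exact.
  have [J CJ Jg] : exists2 J, C J & forall i, sval J (g i).
    have {gE} gC i : exists2 J, C J & sval J (g i).
      by have := generated_gen g i; rewrite -gE.
    elim: m g gC => [|m IH] g gC; first by exists J0 => // -[].
    have [J CJ Jg] := IH (fun i => g (widen_ord (leqnSn m) i)) (fun i => gC _).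
    have [K CK Kg] := gC ord_max.
    have [JK|KJ] := Ctot J K CJ CK.
      exists K => // i; have [->//|im] := eqVneq i ord_max.
      have im' : (i < m)%N by rewrite ltn_neqAle -ltnS ltn_ord andbT.
      by rewrite (_ : i = widen_ord (leqnSn m) (Ordinal im')); [exact/JK/Jg|exact: val_inj].
    exists J => // i; have [->|im] := eqVneq i ord_max; first exact: KJ.
    have im' : (i < m)%N by rewrite ltn_neqAle -ltnS ltn_ord andbT.
    by rewrite (_ : i = widen_ord (leqnSn m) (Ordinal im')); [exact: Jg|exact: val_inj].
  exists J => K CK; apply/asboolP => a Ka.
  have : generated g a by rewrite -gE; exists K.
  by apply: generated_sub => //; exact/GI/svalP.
exists M; split=> // M' GM' MM'.
by have /(congr1 sval)/= -> := Mmax (exist _ M' GM') (asboolT MM').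
Qed.

(** The image of the field is noetherian, its only ideals being zero and itself; the generators are
    then adjoined one by one with Hilbert's basis theorem. *)
Lemma noetherian_fg_algebra (K : fieldType) (str : {rmorphism K -> A}) :
  finitely_generated_algebra str -> max_noetherian.
Proof.
move=> [m [g gen]].
have base : subring (range str) /\ noetherian_subring (range str).
  split.
    split.
    - by exists 1; rewrite ?rmorph1.
    - by move=> _ _ [a _ <-] [b _ <-]; exists (a - b); rewrite ?rmorphB.
    - by move=> _ _ [a _ <-] [b _ <-]; exists (a * b); rewrite ?rmorphM.
  move=> G GF [M0 GM0].
  have [[M GM [a [Ma a0]]]|nG] := pselect (exists2 M, G M & exists a, M a /\ a <> 0).
    exists M; split=> // M' GM' _ x M'x.
    have [[_ _ MZ] MS] := GF _ GM; have [c _ ca] := MS _ Ma.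
    have [_ M'S] := GF _ GM'; have [d _ <-] := M'S _ M'x.
    have c0 : c != 0 by apply/eqP => c0; apply: a0; rewrite -ca c0 rmorph0.
    rewrite -(divfK c0 d) rmorphM; have := MZ (str (d / c)) a _ Ma; rewrite -ca; apply.
    by exists (d / c).
  exists M0; split=> // M' GM' _ x M'x.
  have [->|x0] := pselect (x = 0); first by have [[]] := GF _ GM0.
  by exfalso; apply: nG; exists M' => //; exists x.
have step k : (k <= m)%N -> exists S : set A, [/\ subring S, noetherian_subring S,
    range str `<=` S & forall i : 'I_m, (i < k)%N -> S (g i)].
  elim: k => [|k IH] km; first by case: base => Sr Sn; exists (range str); split.
  have [S [Sr Sn strS gS]] := IH (ltnW km).
  exists (adjoin S (g (Ordinal km))); split.
  - exact: adjoin_subring.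
  - exact: noetherian_adjoin.
  - by move=> x /strS; exact: adjoin_sub.
  - move=> i; rewrite ltnS leq_eqVlt => /orP[/eqP ik|/gS]; last exact: adjoin_sub.
    rewrite (_ : i = Ordinal km); [exact: (adjoin_gen Sr)|exact: val_inj].
have [S [Sr Sn strS gS]] := step m (leqnn m).
have ST : S = setT by apply: gen => // [c|i]; [apply: strS; exists c|exact: gS].
by rewrite /max_noetherian -ST.
Qed.

End Noetherian.

(** * Extending linear maps from saturated submodules *)

Section Extension.
Variables (A : comPzRingType) (z : A) (N : nat).
Hypothesis noethA : max_noetherian A.
Hypothesis zN : z ^+ N.+1 = 0.
Hypothesis z_ann : forall a, z ^+ N * a = 0 -> principal z a.
Hypothesis z_val : forall a d, ~ principal z a -> ~ principal z d ->
  (exists q c, a = q * d + c * z) \/ (exists q c, d = q * a + c * z).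

(** The graph of a partial linear map from A^r to A, the last clause being single-valuedness. A
    relation spares a type for the domain, which grows during the proof. *)
Definition lin_rel r (Phi : 'rV[A]_r -> A -> Prop) :=
  [/\ Phi 0 0,
      forall v w b c, Phi v b -> Phi w c -> Phi (v + w) (b + c),
      forall a v b, Phi v b -> Phi (a *: v) (a * b) &
      forall b, Phi 0 b -> b = 0].

Definition rel_dom r (Phi : 'rV[A]_r -> A -> Prop) := [set v | exists b, Phi v b].

Definition saturated r (M : set 'rV[A]_r) :=
  forall d v, ~ principal z d -> M (d *: v) -> M v.

Lemma rel_dom_submod r (Phi : 'rV[A]_r -> A -> Prop) :
  lin_rel Phi -> submod_over setT (rel_dom Phi).
Proof.
case=> P0 PD PZ _; split=> [|v w [b Pb] [c Pc]|a v _ [b Pb]].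
- by exists 0.
- by exists (b + c); exact: PD.
- by exists (a * b); exact: PZ.
Qed.

(** The submodule M + Ae. *)
Definition cyclic_ext r (M : set 'rV[A]_r) e := [set v | exists a, M (v - a *: e)].

Lemma cyclic_ext_submod r (M : set 'rV[A]_r) e :
  submod_over setT M -> submod_over setT (cyclic_ext M e).
Proof.
case=> M0 MD MZ; split=> [|v w [a Ma] [b Mb]|c v _ [a Ma]].
- by exists 0; rewrite scale0r subr0.
- exists (a + b); rewrite scalerDl opprD addrACA; exact: MD.
- exists (c * a); rewrite -scalerA -scalerBr; exact: MZ.
Qed.

(* The hypothesis on A says that A is Gorenstein of dimension at most 1, and the
   saturation that the cokernel is torsion free, so that this is Ext^1 = 0 for
   torsion free modules.  We adjoin e with z e in the domain, whose value y must
   solve z y = Phi (z e); z_ann provides it. *)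
Lemma saturated_extension r (Phi : 'rV[A]_r -> A -> Prop) :
  lin_rel Phi -> saturated (rel_dom Phi) ->
  exists y : 'I_r -> A, forall v b, Phi v b -> b = \sum_(i < r) v 0 i * y i.
Proof.
move=> Plin Psat.
pose good Psi := [/\ @lin_rel r Psi, saturated (rel_dom Psi) &
  forall v b, Phi v b -> Psi v b].
have noethr := noetherian_subring_rV (@subringT A) (r := r) noethA.
(* Noetherianity of A^r, applied to the domains, yields an extension with maximal domain. *)
have [||_ [[Psi [[P0 PD PZ Pu] Ssat PhiPsi] <-] Psimax]] :=
    noethr [set M | exists2 Psi, good Psi & rel_dom Psi = M].
- by move=> _ [Psi [/rel_dom_submod Psub _ _] <-].
- by exists (rel_dom Phi), Phi.
have Plin' : lin_rel Psi by [].
have PN v b : Psi v b -> Psi (- v) (- b).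
  by move=> /(PZ (-1)); rewrite scaleN1r mulN1r.
have [D0 DD DZ] := rel_dom_submod Plin'.
have full v : rel_dom Psi v.
  apply: contrapT => Dv.
  pose E := [set e | ~ rel_dom Psi e /\ rel_dom Psi (z *: e)].
  (* [z] is nilpotent, so the last power of [z] that keeps [v] outside the domain yields an element
     of [E]. *)
  have [e0 E0] : E !=set0.
    have [|k Dk kmin] := @ex_minnP (fun k => `[< rel_dom Psi (z ^+ k *: v) >]).
      by exists N.+1; apply/asboolP; rewrite zN scale0r.
    move/asboolP: Dk; case: k kmin => [|k] kmin Dk.
      by exfalso; apply: Dv; rewrite -[v]scale1r -(expr0 z).
    exists (z ^+ k *: v); split; last by rewrite scalerA -exprS.
    by move=> /asboolP/kmin; rewrite ltnn.
  (* An arbitrary [e] could be, modulo the domain, a multiple of another element by a scalar outside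
     (z), and the new domain would not be saturated. *)
  have [||_ [[e [De [bz Pz]] <-] emax]] := noethr (cyclic_ext (rel_dom Psi) @` E).
  - by move=> _ [e _ <-]; split=> //; exact: cyclic_ext_submod.
  - by exists (cyclic_ext (rel_dom Psi) e0), e0.
  have [y yE] : exists y, bz = y * z.
    apply: z_ann; apply: Pu; have := PZ (z ^+ N) _ _ Pz.
    by rewrite scalerA -exprSr zN scale0r.
  pose Psi' v b := exists a w c, [/\ Psi w c, v = w + a *: e & b = c + a * y].
  have in_ext v' : cyclic_ext (rel_dom Psi) e v' -> rel_dom Psi' v'.
    move=> [a [c Pc]]; exists (c + a * y), a, (v' - a *: e), c; split=> //.
    by rewrite subrK.
  have ext_in v' : rel_dom Psi' v' -> cyclic_ext (rel_dom Psi) e v'.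
    by move=> [_ [a [w [c [Pc -> _]]]]]; exists a; rewrite addrK; exists c.
  have good' : good Psi'.
    split.
    - split.
      + by exists 0, 0, 0; rewrite scale0r mul0r !addr0.
      + move=> _ _ _ _ [a [w [c [Pc -> ->]]]] [a' [w' [c' [Pc' -> ->]]]].
        exists (a + a'), (w + w'), (c + c'); split; first exact: PD.
          by rewrite scalerDl addrACA.
        by rewrite mulrDl addrACA.
      + move=> s _ _ [a [w [c [Pc -> ->]]]].
        exists (s * a), (s *: w), (s * c); split; first exact: PZ.
          by rewrite scalerDr scalerA.
        by rewrite mulrDr mulrA.
      + move=> _ [a [w [c [Pc we ->]]]].
        have wE : w = - (a *: e) by apply/eqP; rewrite -addr_eq0 -we.
        (* If [a] is a multiple of [z], the choice of [y] matches the old value at [a *: e];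
           otherwise saturation would put [e] in the old domain. *)
        have [[a' aE]|za] := pselect (principal z a).
          have := PZ a' _ _ Pz; rewrite scalerA -aE yE => Pa.
          have := PD _ _ _ _ Pc Pa; rewrite -we => /Pu.
          by rewrite aE -mulrA [z * y]mulrC.
        exfalso; apply: De; apply: (Ssat a) => //.
        by exists (- c); rewrite -[a *: e]opprK -wE; exact: PN.
    - move=> d v' zd /ext_in[a [c Pc]]; apply: in_ext.
      have [Dv'|Dv'] := pselect (rel_dom Psi v').
        by exists 0; rewrite scale0r subr0.
      have Dzv' : rel_dom Psi (z *: v').
        apply: (Ssat d) => //; rewrite scalerA mulrC -scalerA.
        rewrite -(subrK (a *: e) (d *: v')) scalerDr; apply: DD.
          by apply: DZ => //; exists c.
        by rewrite scalerA mulrC -scalerA; apply: DZ => //; exists bz.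
      have [[a' aE]|za] := pselect (principal z a).
        exfalso; apply: Dv'; apply: (Ssat d) => //.
        rewrite -(subrK (a *: e) (d *: v')); apply: DD; first by exists c.
        by rewrite aE -scalerA; apply: DZ => //; exists bz.
      (* Compare [a] and [d] modulo [z], knowing that [z *: e] and [z *: v'] are in the domain M. If
         [d] divides [a], then [v' - q *: e] is in M. If [a] divides [d], then [e] is [q *: v']
         modulo M, so M + Av' contains M + Ae, and maximality makes them equal. *)
      have [[q [s aE]]|[q [s dE]]] := z_val za zd.
        exists q; apply: (Ssat d) => //.
        rewrite (_ : _ *: _ = (d *: v' - a *: e) + s *: (z *: e)).
          by apply: DD; [exists c|apply: DZ => //; exists bz].
        by rewrite aE scalerBr !scalerA scalerDl mulrC opprD -addrA subrK.
      have : rel_dom Psi (q *: v' - e).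
        apply: (Ssat a) => //.
        rewrite (_ : _ *: _ = (d *: v' - a *: e) - s *: (z *: v')).
          apply: DD; first by exists c.
          by rewrite -scaleNr; apply: DZ.
        by rewrite dE scalerBr !scalerA scalerDl mulrC addrAC addrK.
      move=> [f Pf].
      apply: (emax (cyclic_ext (rel_dom Psi) v')).
      + by exists v'.
      + move=> u [t Du]; exists (t * q).
        rewrite (_ : _ - _ = (u - t *: e) + (- t) *: (q *: v' - e)).
          by apply: DD => //; apply: DZ => //; exists f.
        by rewrite scaleNr scalerBr scalerA opprB addrA subrK.
      + by exists 1; rewrite scale1r subrr.
    - move=> v' b /PhiPsi Pb; exists 0, v', b.
      by rewrite scale0r mul0r !addr0.
  apply: De; apply: (Psimax (rel_dom Psi')); first by exists Psi'.
    by move=> v' Dv'; apply: in_ext; exists 0; rewrite scale0r subr0.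
  by apply: in_ext; exists 1; rewrite scale1r subrr.
have [y yP] := choice (fun i : 'I_r => full (delta_mx 0 i)).
exists y => v b Pb.
have Psum : Psi (\sum_(i < r) v 0 i *: delta_mx 0 i) (\sum_(i < r) v 0 i * y i).
  by apply: (big_ind2 Psi) => // [*|i _]; [exact: PD|exact: PZ].
apply/eqP; rewrite -subr_eq0; apply/eqP/Pu.
rewrite -(subrr v); apply: PD; first exact: PhiPsi.
by rewrite {1}(row_sum_delta v); exact: PN.
Qed.

End Extension.

(** * Local algebra *)

Section LocalRings.
Variable A : comPzRingType.
Implicit Types a b c d t x z : A.

Lemma is_unit1 : is_unit (1 : A).
Proof. by exists 1; rewrite mulr1. Qed.

Lemma is_unitMl a b : is_unit (a * b) -> is_unit a.
Proof. by move=> [c e]; exists (b * c); rewrite mulrA. Qed.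

Lemma is_unitX a k : is_unit a -> is_unit (a ^+ k).
Proof. by move=> [b e]; exists (b ^+ k); rewrite -exprMn e expr1n. Qed.

Lemma is_unit_reg a b : is_unit a -> a * b = 0 -> b = 0.
Proof. by move=> [c ac] ab; rewrite -[b]mul1r -ac mulrAC ab mul0r. Qed.

Lemma prime_ideal_nonunits I : prime_ideal I -> I `<=` @nonunits A.
Proof.
move=> [[_ _ IM] I1 _] a Ia [b ab]; apply: I1; rewrite -ab mulrC; exact: IM.
Qed.

Lemma prime_idealX I a k : prime_ideal I -> I (a ^+ k) -> I a.
Proof.
move=> [_ I1 IP]; elim: k => [|k IH]; first by rewrite expr0 => /I1.
by rewrite exprS => /IP[].
Qed.

Lemma prime_chainW m k : (m <= k)%N -> prime_chain A k -> prime_chain A m.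
Proof.
move=> mk [p [pP pS]]; exists p; split=> i im; first exact: pP (leq_trans im mk).
exact: pS (leq_trans im mk).
Qed.

Hypothesis localA : local_ring A.

Lemma is_unit_1B x : nonunits x -> is_unit (1 - x).
Proof.
move=> nx; apply: contrapT => n1x; have [_ nD _] := localA.
by have := nD _ _ n1x nx; rewrite subrK; apply; exact: is_unit1.
Qed.

Lemma local_neq01 : 0 <> 1 :> A.
Proof. by move=> e; have [n0 _ _] := localA; apply: n0; rewrite e; exact: is_unit1. Qed.

(* The case of interest: A/(z) is a discrete valuation ring with uniformizer t. *)
Definition dvr_quotient t z :=
  [/\ nonunits t, nonunits z,
      forall a, nonunits a -> exists x y, a = x * t + y * z &
      forall a, ~ principal z a ->
        exists u j c, is_unit u /\ a = u * t ^+ j + c * z].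

(** Noetherian induction on the ideal (a, z). Writing a nonunit as [a1 * t + y * z] and passing to
    [a1] enlarges it strictly: if [a1] were in (a, z), then [(1 - x * t) * a1] would be a multiple
    of [z] for some [x], and [1 - x * t] is a unit. *)
Lemma dvr_quotientI t z : max_noetherian A -> nonunits t -> nonunits z ->
  (forall a, nonunits a -> exists x y, a = x * t + y * z) -> dvr_quotient t z.
Proof.
move=> noethA nt nz gen; split=> // a0 a0z; apply: contrapT => bad0.
pose bad a := ~ principal z a /\ ~ exists u j c, is_unit u /\ a = u * t ^+ j + c * z.
pose I a := [set b | exists x y, b = x * a + y * z].
have [||_ [[a [az nform] <-] amax]] := noeth_max (G := I @` bad) noethA.
- move=> _ [a _ <-]; split.
  + by exists 0, 0; rewrite !mul0r addr0.
  + by move=> _ _ [x [y ->]] [x' [y' ->]]; exists (x + x'), (y + y'); ring.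
  + by move=> c _ [x [y ->]]; exists (c * x), (c * y); ring.
- by exists (I a0), a0.
have na : nonunits a.
  by move=> ua; apply: nform; exists a, 0%N, 0; split=> //; ring.
have [a1 [y aE]] := gen _ na.
have a1z : ~ principal z a1.
  by move=> [c a1E]; apply: az; exists (c * t + y); rewrite aE a1E; ring.
have bad1 : bad a1.
  split=> // -[u [j [c [uu a1E]]]]; apply: nform.
  by exists u, j.+1, (c * t + y); split=> //; rewrite aE a1E exprS; ring.
have : I a a1.
  have -> : I a = I a1.
    apply/esym/amax; first by exists a1.
    by move=> _ [x [y' ->]]; exists (x * t), (x * y + y'); rewrite aE; ring.
  by exists 1, 0; ring.
move=> [x [w a1E]]; apply: a1z.
have [|v uv] := @is_unit_1B (x * t).
  by have [_ _ nM] := localA; exact: nM.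
exists (v * (x * y + w)).
rewrite -[LHS]mul1r -uv.
have -> : (1 - x * t) * v * a1 = v * (a1 - x * t * a1) by ring.
by rewrite {1}a1E {1}aE; ring.
Qed.

Lemma dvr_quotient_val t z a d : dvr_quotient t z ->
  ~ principal z a -> ~ principal z d ->
  (exists q c, a = q * d + c * z) \/ (exists q c, d = q * a + c * z).
Proof.
move=> [_ _ _ form] /form[u [j [c [[u' uu'] ->]]]] /form[v [k [e [[v' vv'] ->]]]].
have [jk|kj] := leqP j k.
  right; exists (v * u' * t ^+ (k - j)), (e - v * u' * t ^+ (k - j) * c).
  rewrite -[in t ^+ k](subnK jk) exprD.
  have -> : v * (t ^+ (k - j) * t ^+ j) = (u * u') * (v * (t ^+ (k - j) * t ^+ j)).
    by rewrite uu' mul1r.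
  by ring.
left; exists (u * v' * t ^+ (j - k)), (c - u * v' * t ^+ (j - k) * e).
rewrite -[in t ^+ j](subnK (ltnW kj)) exprD.
have -> : u * (t ^+ (j - k) * t ^+ k) = (v * v') * (u * (t ^+ (j - k) * t ^+ k)).
  by rewrite vv' mul1r.
by ring.
Qed.

(** The nonunit [x] witnesses positive depth. An [a] outside (z) killed by [z ^+ N] gives
    [z ^+ N * t ^+ j = 0]; as [x] is a multiple of [t] modulo [z], then [z ^+ N * x ^+ j = 0], hence
    [z ^+ N = 0], against the minimality of the exponent. *)
Lemma dvr_quotient_ann t z n x : dvr_quotient t z -> z ^+ n = 0 ->
  nonunits x -> (forall a, x * a = 0 -> a = 0) ->
  exists N, z ^+ N.+1 = 0 /\ forall a, z ^+ N * a = 0 -> principal z a.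
Proof.
move=> [_ _ gen form] zn nx xreg.
have [|[|N] zN Nmin] := @ex_minnP (fun n => z ^+ n == 0).
- by exists n; rewrite zn.
- by case: local_neq01; apply/esym/eqP; rewrite -(expr0 z).
exists N; split=> [|a za]; first exact/eqP.
apply: contrapT => /form[u [j [c [uu aE]]]].
have ztj : z ^+ N * t ^+ j = 0.
  apply: (is_unit_reg uu); move: za; rewrite aE mulrDr.
  have -> : z ^+ N * (c * z) = c * z ^+ N.+1 by rewrite exprSr; ring.
  by rewrite (eqP zN) mulr0 addr0 mulrCA.
have [x1 [x2 xE]] := gen _ nx.
have zxk k : z ^+ N * x ^+ k = z ^+ N * t ^+ k * x1 ^+ k.
  elim: k => [|k IH]; first by rewrite !expr0; ring.
  rewrite exprS mulrCA IH xE !exprS.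
  have -> : (x1 * t + x2 * z) * (z ^+ N * t ^+ k * x1 ^+ k) =
    z ^+ N * (t * t ^+ k) * (x1 * x1 ^+ k) + x2 * t ^+ k * x1 ^+ k * (z * z ^+ N) by ring.
  by rewrite -[z * z ^+ N]exprS (eqP zN) mulr0 addr0.
have : z ^+ N * x ^+ j = 0 by rewrite zxk ztj mul0r.
have xregX k b : x ^+ k * b = 0 -> b = 0.
  elim: k => [|k IH]; first by rewrite expr0 mul1r.
  by rewrite exprS -mulrA => /xreg/IH.
rewrite mulrC => /xregX zN0.
by have := Nmin N; rewrite zN0 eqxx ltnn => /(_ isT).
Qed.

(** With [d = u * t ^+ j + c * z], the power [t ^+ j] and hence [r ^+ j] lies in (d, z); the [n]-th
    power of this relation removes the part in [z]. *)
Lemma dvr_quotient_rad t z n d r : dvr_quotient t z -> z ^+ n = 0 ->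
  ~ principal z d -> nonunits r -> exists k c, r ^+ k = c * d.
Proof.
move=> [_ _ gen form] zn /form[u [j [c [[u' uu'] dE]]]] nr.
have [x [y rE]] := gen _ nr.
have rX k : exists w, r ^+ k = x ^+ k * t ^+ k + w * z.
  elim: k => [|k [w IH]]; first by exists 0; rewrite !expr0; ring.
  by exists (x * t * w + y * r ^+ k); rewrite exprS {1}rE mulrDl {1}IH !exprS; ring.
have [w rj] := rX j.
have {}rj : exists w', r ^+ j = x ^+ j * u' * d + w' * z.
  exists (w - x ^+ j * u' * c); rewrite rj dE.
  have -> : x ^+ j * t ^+ j = u * u' * (x ^+ j * t ^+ j) by rewrite uu' mul1r.
  by ring.
have {rj}[w' rj] := rj.
have rjX k : exists q, r ^+ (j * k) = q * d + w' ^+ k * z ^+ k.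
  elim: k => [|k [q IH]]; first by exists 0; rewrite muln0 !expr0; ring.
  exists (r ^+ j * q + x ^+ j * u' * w' ^+ k * z ^+ k).
  by rewrite mulnS exprD IH {1 2}rj !exprS; ring.
have [q qE] := rjX n.
by exists (j * n)%N, q; rewrite qE zn mulr0 addr0.
Qed.

End LocalRings.

(** * Surjections of local rings and the ideal of a curve *)

Section Surjections.
Variables (B C : comPzRingType) (q : {rmorphism B -> C}).

Lemma rmorph_is_unit b : is_unit b -> is_unit (q b).
Proof. by move=> [c bc]; exists (q c); rewrite -rmorphM bc rmorph1. Qed.

Lemma rmorph_nonunits b : nonunits (q b) -> nonunits b.
Proof. by move=> nq /rmorph_is_unit. Qed.

Hypothesis q_surj : forall c, exists b, q b = c.
Hypothesis localB : local_ring B.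
Hypothesis localC : local_ring C.

(** The kernel consists of nonunits, as [C] is not the zero ring. *)
Lemma surj_local b : is_unit (q b) -> is_unit b.
Proof.
move=> [c' bc]; have [c cE] := q_surj c'.
have n : nonunits (1 - b * c).
  move=> /rmorph_is_unit; rewrite rmorphB rmorphM cE bc rmorph1 subrr.
  by have [] := localC.
by apply: (@is_unitMl _ b c); have := is_unit_1B localB n; rewrite opprB addrC subrK.
Qed.

Lemma dvr_quotient_surj t z : dvr_quotient t z -> dvr_quotient (q t) (q z).
Proof.
move=> [nt nz gen form]; split.
- by move=> /surj_local.
- by move=> /surj_local.
- move=> a'; have [a <-] := q_surj a' => /rmorph_nonunits/gen[x [y ->]].
  by exists (q x), (q y); rewrite rmorphD !rmorphM.
- move=> a'; have [a <-] := q_surj a' => az.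
  have [|u [j [c [uu ->]]]] := form a.
    by move=> [b ab]; apply: az; exists (q b); rewrite ab rmorphM.
  exists (q u), j, (q c); split; first exact: rmorph_is_unit.
  by rewrite rmorphD !rmorphM rmorphXn.
Qed.

(* The ideal of a curve with a regular local ring C in a surface with local ring B *)
Lemma kernel_principal e (g : 'I_e -> B) (h : 'I_1 -> C) :
  max_noetherian B -> (e <= 2)%N -> @nonunits B = generated g -> @nonunits C = generated h ->
  prime_chain C 1 ->
  exists t z, dvr_quotient t z /\ [set b | q b = 0] = principal z.
Proof.
move=> noethB e2 mB mC chainC.
(* If the generator of the maximal ideal were nilpotent, every prime would contain all nonunits,
   which a strict chain of two primes forbids. *)
have not_nil : forall k, h ord0 ^+ k <> 0.
  move=> k hk; have [p [pP pS]] := chainC.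
  have p0 := pP 0%N isT; have p1 := pP 1%N isT.
  have [_ np] := pS 0%N isT; apply: np => c p1c.
  have : nonunits c by exact: prime_ideal_nonunits p1c.
  rewrite mC => -[d ->]; rewrite big_ord1; have [[p00 _ pM] _ _] := p0.
  by apply: pM; apply: (@prime_idealX _ _ _ k) => //; rewrite hk.
have [a [b [na nb gab]]] : exists a b : B, [/\ nonunits a, nonunits b &
    forall x, nonunits x -> exists y w, x = y * a + w * b].
  have n0 : nonunits (0 : B) by have [] := localB.
  have ng i : nonunits (g i) by rewrite mB; exact: generated_gen.
  case: e => [|[|[|//]]] in g e2 mB ng *.
  - exists 0, 0; split=> // x; rewrite mB => -[c ->].
    by exists 0, 0; rewrite big_ord0 !mul0r addr0.
  - exists (g ord0), 0; split=> // x; rewrite mB => -[c ->].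
    by exists (c ord0), 0; rewrite big_ord1 !mul0r addr0.
  - exists (g ord0), (g (lift ord0 ord0)); split=> // x; rewrite mB => -[c ->].
    by exists (c ord0), (c (lift ord0 ord0)); rewrite big_ord_recl big_ord1.
have [t tE] := q_surj (h ord0).
have nt : nonunits t by apply: rmorph_nonunits; rewrite tE mC; exact: generated_gen.
have modt x : nonunits x -> exists c y, x = c * t + y /\ q y = 0.
  move=> nx; have : nonunits (q x) by move=> /surj_local.
  rewrite mC => -[c']; rewrite big_ord1; have [c <-] := q_surj (c' ord0).
  move=> xE; exists c, (x - c * t); split; first by ring.
  by rewrite rmorphB rmorphM tE xE subrr.
have [ca [ja [aE qa]]] := modt _ na.
have [cb [jb [bE qb]]] := modt _ nb.
have nM (x y : B) : nonunits y -> nonunits (x * y) by have [_ _ H] := localB; exact: H.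
have nker y : q y = 0 -> nonunits y.
  move=> qy /rmorph_is_unit; rewrite qy; by have [] := localC.
(* Expand the lift [t] in [a] and [b]. A unit coefficient lets [t] replace that generator, and [z]
   is the kernel part of the other one. Without a unit coefficient, a unit multiple of [t] would be
   in the kernel, although [q t] is not zero. *)
have [z [qz gen]] : exists z : B, q z = 0 /\
    forall x, nonunits x -> exists y w, x = y * t + w * z.
  have [gc [gd tab]] := gab _ nt.
  have [[c' ugc]|ngc] := pselect (is_unit gc).
    exists jb; split=> // x /gab[y [w ->]].
    have -> : a = c' * (gc * a) by rewrite mulrA [c' * _]mulrC ugc mul1r.
    have -> : gc * a = t - gd * b by rewrite tab; ring.
    by rewrite bE; exists (y * c' * (1 - gd * cb) + w * cb), (w - y * c' * gd); ring.
  have [[d' ugd]|ngd] := pselect (is_unit gd).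
    exists ja; split=> // x /gab[y [w ->]].
    have -> : b = d' * (gd * b) by rewrite mulrA [d' * _]mulrC ugd mul1r.
    have -> : gd * b = t - gc * a by rewrite tab; ring.
    by rewrite aE; exists (w * d' * (1 - gc * ca) + y * ca), (y - w * d' * gc); ring.
  exfalso; apply: (not_nil 1%N); rewrite expr1 -tE.
  have u : is_unit (1 - (gc * ca + gd * cb)).
    apply: is_unit_1B => //; have [_ nD _] := localB.
    by apply: nD; rewrite mulrC; exact: nM.
  apply: (is_unit_reg (rmorph_is_unit u)); rewrite -rmorphM.
  have -> : (1 - (gc * ca + gd * cb)) * t = gc * ja + gd * jb.
    have -> : (1 - (gc * ca + gd * cb)) * t = t - (gc * (ca * t) + gd * (cb * t)) by ring.
    by rewrite {1}tab {1}aE {1}bE; ring.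
  by rewrite rmorphD !rmorphM qa qb !mulr0 addr0.
have nz := nker _ qz.
have dvr := dvr_quotientI localB noethB nt nz gen.
exists t, z; split=> //; apply/seteqP; split=> [x /= qx|_ [c ->]]; last first.
  by rewrite /= rmorphM qz mulr0.
(* An element of the kernel outside (z) is [u * t ^+ j + c * z] with [u] a unit, so [h ord0 ^+ j]
   would vanish. *)
apply: contrapT; have [_ _ _ form] := dvr => /form[u [j [c [uu xE]]]].
apply: (not_nil j); apply: (is_unit_reg (rmorph_is_unit uu)).
by rewrite -tE -rmorphXn -rmorphM; move: qx; rewrite xE rmorphD (rmorphM _ c) qz mulr0 addr0.
Qed.

End Surjections.

(** * Charts, specialization of points and localization *)

Section Germs.
Variables (K : comPzRingType) (X : ringedSpace K).

Section AtPoint.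
Variable x : X.

Lemma germ_is_zmod_morphism (U : opens X) (Ux : oset U x) : zmod_morphism (germ Ux).
Proof. by move=> s t; rewrite -germD -germN. Qed.

Lemma germ_is_monoid_morphism (U : opens X) (Ux : oset U x) : monoid_morphism (germ Ux).
Proof. by split=> [|s t]; rewrite ?germ1 -?germM. Qed.

HB.instance Definition _ (U : opens X) (Ux : oset U x) :=
  GRing.isZmodMorphism.Build (sect U) (stalk x) (germ Ux) (germ_is_zmod_morphism Ux).
HB.instance Definition _ (U : opens X) (Ux : oset U x) :=
  GRing.isMonoidMorphism.Build (sect U) (stalk x) (germ Ux) (germ_is_monoid_morphism Ux).

Lemma germ_irr (U : opens X) (Ux Ux' : oset U x) s : germ Ux s = germ Ux' s.
Proof. by rewrite (Prop_irrelevance Ux Ux'). Qed.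

Lemma germ_eq_res (U : opens X) (Ux : oset U x) s t : germ Ux s = germ Ux t ->
  exists (V : opens X) (h : V `<=` U), oset V x /\ res h s = res h t.
Proof.
move=> /germ_eq[V [h [h' [Vx e]]]]; exists V, h; split=> //.
by rewrite e (Prop_irrelevance h' h).
Qed.

Lemma germ_is_unit (U : opens X) (Ux : oset U x) s : is_unit (germ Ux s) ->
  exists (V : opens X) (h : V `<=` U), oset V x /\ is_unit (res h s).
Proof.
move=> [c]; have [V [Vx [t ->]]] := germ_surj c.
pose W := opensI U V; have Wx : oset W x by [].
rewrite -(germ_res (@opensIl _ U V) Ux Wx) -(germ_res (@opensIr _ U V) Vx Wx).
rewrite -rmorphM -(rmorph1 (germ Wx)) => /germ_eq_res[W' [h [W'x e]]].
exists W', (subset_trans h (@opensIl _ U V)); split=> //.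
exists (res h (res (@opensIr _ U V) t)).
by move: e; rewrite rmorphM rmorph1 (res_comp _ _ (subset_trans h (@opensIl _ U V))).
Qed.

End AtPoint.

(** That is, [p] lies in the closure of [x]; germs at [p] then restrict to germs at [x]. *)
Definition specializes (x p : X) := forall V : opens X, oset V p -> oset V x.

Lemma specializes_trans x y p : specializes x y -> specializes y p -> specializes x p.
Proof. by move=> xy yp V /yp/xy. Qed.

Lemma closed_point p :
  closed [set p] <-> forall y, specializes p y -> y = p.
Proof.
split=> [pcl y py|pspec].
  apply: contrapT => yp.
  by have := py (Opens (closed_openC pcl)) yp; apply.
rewrite closure_id; apply/seteqP; split; first exact: subset_closure.
move=> y ypcl; apply: pspec => V Vy.
by have [_ [-> Vp]] := ypcl _ (open_nbhs_nbhs (conj (open_oset V) Vy)).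
Qed.

Section SpecializationMap.
Variables (x p : X) (xp : specializes x p).

Definition sp_map (a : stalk p) : stalk x := germ (xp (germ_in (repr a))) (germ_val (repr a)).

Lemma sp_germ (U : opens X) (Up : oset U p) (s : sect U) :
  sp_map (germ Up s) = germ (xp Up) s.
Proof.
rewrite /sp_map; set a := repr _.
have /germ_eq[W [h1 [h2 [Wp e]]]] : germ (germ_in a) (germ_val a) = germ Up s.
  by rewrite -[RHS]reprK /germ -/a; case: (a).
by apply/germ_eq; exists W, h1, h2; split=> //; exact: xp.
Qed.

Lemma sp_is_zmod_morphism : zmod_morphism sp_map.
Proof.
move=> a b; have [U [Up [s [t [-> ->]]]]] := germ_surj2 a b.
by rewrite -rmorphB !sp_germ rmorphB.
Qed.

Lemma sp_is_monoid_morphism : monoid_morphism sp_map.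
Proof.
split=> [|a b]; first by rewrite [1]/(stalk_one p) sp_germ rmorph1.
have [U [Up [s [t [-> ->]]]]] := germ_surj2 a b.
by rewrite -rmorphM !sp_germ rmorphM.
Qed.

HB.instance Definition _ := GRing.isZmodMorphism.Build (stalk p) (stalk x)
  sp_map sp_is_zmod_morphism.
HB.instance Definition _ := GRing.isMonoidMorphism.Build (stalk p) (stalk x)
  sp_map sp_is_monoid_morphism.

End SpecializationMap.

End Germs.

(** * Points of affine schemes as primes *)

Section AffineSpaces.
Variables (K : comPzRingType) (Y : ringedSpace K).
Implicit Types (w y : Y).

Definition global_germ y : sect (opensT Y) -> stalk y := germ (I : oset (opensT Y) y).

HB.instance Definition _ y := GRing.RMorphism.on (global_germ y).

(** The prime of [y] recovered from the sheaf alone, independently of the ring and the map [pt]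
    chosen in [is_spec]. *)
Definition vanishing y : set (sect (opensT Y)) :=
  [set b | ~ is_unit (global_germ y b)].

Lemma vanishing_specializes y w : specializes y w -> vanishing y `<=` vanishing w.
Proof.
move=> yw b yb ub; apply: yb.
rewrite /global_germ (germ_irr _ (yw (opensT Y) I)) -sp_germ.
exact: rmorph_is_unit.
Qed.

(** All later use of affineness goes through these four facts. The proof identifies the preimage of
    [vanishing y] under [theta] with [pt y]. *)
Lemma affine_vanishing : affine Y ->
  [/\ forall w, is_ideal (vanishing w),
      forall y w, vanishing y `<=` vanishing w -> specializes y w,
      forall y w, vanishing y = vanishing w -> y = w &
      forall y (a : stalk y), exists s f, is_unit (global_germ y s) /\
        a * global_germ y s = global_germ y f].
Proof.
move=> [A [pt [theta [[pt_inj pt_range] pt_open pt_loc]]]].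
have ptP y : prime_ideal (pt y).
  have : range pt (pt y) by exists y.
  by rewrite pt_range.
have openD f : open [set y | ~ pt y f].
  apply/pt_open; exists [set f]; apply/seteqP; split=> y /= n; last by move=> yf; apply: n => _ ->.
  by move=> s; apply: n; exact: s.
pose D f := Opens (openD f).
have Dsub (U : opens Y) y : oset U y -> exists2 f, oset (D f) y & D f `<=` U.
  have [J ->] := (pt_open U).1 (open_oset U).
  move=> /= /existsNP[f /not_implyP[Jf yf]]; exists f => //.
  by move=> w /= wf Jw; apply: wf; exact: Jw.
have germD f y (Dy : oset (D f) y) b :
    germ Dy (res (@opens_subT _ (D f)) b) = global_germ y b by exact: germ_res.
(* The whole space is D(1), so surjectivity of [theta] is the localization property for 1. *)
have surj b : exists f, theta f = b.
  have TD : oset (opensT Y) = [set y | ~ pt y 1].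
    by apply/seteqP; split=> // y _; have [_] := ptP y.
  have [_ /(_ b)[f [k fE]] _] := pt_loc 1 (opensT Y) TD.
  by exists f; move: fE; rewrite !res_id rmorph1 expr1n mulr1.
have unitP f y : is_unit (global_germ y (theta f)) <-> ~ pt y f.
  (* A unit germ is a unit on some D(g) containing [y]. Clearing denominators there makes a power of
     [g] a multiple of [f], so [f] in [pt y] would put [g] in it. *)
  split=> [u yf|yf].
    have [V [h [Vy [c e]]]] := germ_is_unit u.
    have [g Dgy DgV] := Dsub _ _ Vy.
    have [_ /(_ (res DgV c))[a [k aE]] inj] := pt_loc g (D g) erefl.
    have := congr1 (res DgV) e; rewrite rmorphM (res_comp _ _ (@opens_subT _ (D g))) rmorph1 => {}e.
    have [|m gm] := inj (f * a - g ^+ k).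
      by rewrite !(rmorphB, rmorphM, rmorphXn) -aE mulrA e mul1r subrr.
    have [[p0 _ pM] _ pp] := ptP y.
    have : pt y (g ^+ (m + k)).
      have -> : g ^+ (m + k) = g ^+ m * a * f.
        by apply/eqP; rewrite exprD eq_sym -subr_eq0 -mulrA -mulrBr mulrC [a * f]mulrC mulrC gm.
      exact: pM.
    by move=> /(prime_idealX (ptP y))/Dgy.
  have [[c cE] _ _] := pt_loc f (D f) erefl.
  by rewrite -(germD _ _ yf); apply: rmorph_is_unit; exists c.
have vanP f y : vanishing y (theta f) <-> pt y f.
  split=> [n|yf /unitP//]; apply: contrapT => yf.
  by apply: n; apply/unitP.
split.
- move=> w; have [[p0 pD pM] _ _] := ptP w; split.
  + by rewrite -(rmorph0 theta); apply/vanP.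
  + move=> b c; have [f <-] := surj b; have [g <-] := surj c.
    by move=> /vanP fw /vanP gw; rewrite -rmorphD; apply/vanP; exact: pD.
  + move=> b c; have [f <-] := surj b; have [g <-] := surj c.
    by move=> /vanP gw; rewrite -rmorphM; apply/vanP; exact: pM.
- move=> y w yw U Uw; have [f Dw] := Dsub _ _ Uw; apply.
  by move=> /= /vanP/yw/vanP.
- move=> y w yw; apply: pt_inj; apply/seteqP; split=> f.
    by move=> /vanP; rewrite yw => /vanP.
  by move=> /vanP; rewrite -yw => /vanP.
- move=> y a; have [U [Uy [s ->]]] := germ_surj a.
  have [g Dy DU] := Dsub _ _ Uy.
  have [_ /(_ (res DU s))[f [k fE]] _] := pt_loc g (D g) erefl.
  exists (theta g ^+ k), (theta f); split.
    by rewrite rmorphXn; apply: is_unitX; exact/unitP.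
  rewrite -(germ_res DU Uy Dy) -(germD _ _ Dy) -(germD _ _ Dy (theta f)).
  by rewrite rmorphXn -rmorphM fE.
Qed.

(** [vanishing w] is taken maximal among the primes containing [vanishing y]. The point [w] is
    closed in the chart only. *)
Lemma affine_closed_specialization y : affine Y -> max_noetherian (sect (opensT Y)) ->
  exists w, specializes y w /\ forall w', specializes w w' -> w' = w.
Proof.
move=> /affine_vanishing[van_id van_sp van_inj _] noethY.
have [||_ [[w yw <-] wmax]] := noeth_max
  (G := vanishing @` [set w | vanishing y `<=` vanishing w]) noethY.
- by move=> _ [w _ <-].
- by exists (vanishing y), y.
exists w; split; first exact: van_sp.
move=> w' /vanishing_specializes ww'; apply: van_inj; apply: wmax => //.
by exists w' => //; exact: subset_trans ww'.
Qed.

Lemma affine_common_zero w : affine Y -> max_noetherian (sect (opensT Y)) ->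
  (forall w', specializes w w' -> w' = w) ->
  exists m (b : 'I_m -> sect (opensT Y)), (forall i, vanishing w (b i)) /\
    forall w', (forall i, vanishing w' (b i)) -> w' = w.
Proof.
move=> /affine_vanishing[van_id van_sp _ _] noethY wcl.
have [m [b bE]] := noeth_fg noethY (van_id w).
exists m, b; split=> [i|w' bw']; first by rewrite bE; exact: generated_gen.
by apply/wcl/van_sp; rewrite bE; apply: generated_sub.
Qed.

End AffineSpaces.

Section Charts.
Variables (K : comPzRingType) (X Y : ringedSpace K) (k : morphism Y X).
Hypothesis affY : affine Y.
Hypothesis immk : open_immersion k.

Definition chart_map y : stalk (k y) -> stalk y := stalk_map (erefl (k y)).
Arguments chart_map : clear implicits.

HB.instance Definition _ y := GRing.RMorphism.on (chart_map y).

Lemma chart_map_inj y : injective (chart_map y).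
Proof. by have [_ _ /(_ y)/bij_inj] := immk. Qed.

Lemma chart_map_surj y a : exists b, chart_map y b = a.
Proof. by have [_ _ /(_ y)[g _ gK]] := immk; exists (g a); exact: gK. Qed.

Lemma chart_map_unit y a : is_unit (chart_map y a) -> is_unit a.
Proof.
move=> [b]; have [c <-] := chart_map_surj b; rewrite -rmorphM => e.
by exists c; apply: chart_map_inj; rewrite e rmorph1.
Qed.

Definition chart_image (V : opens Y) : opens X :=
  Opens (let: And3 _ o _ := immk in o V (open_oset V)).

Lemma chart_specializes y w : specializes (k y) (k w) <-> specializes y w.
Proof.
split=> sp_yw V Vw.
  have [y' Vy' e] := sp_yw (chart_image V) (ex_intro2 _ _ w Vw erefl).
  by have [kinj _ _] := immk; rewrite -(kinj _ _ e).
exact: (sp_yw (opreim (@mor_cont _ _ _ k) V)).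
Qed.

Lemma chart_map_sp y w (s : specializes (k y) (k w)) (s' : specializes y w) a :
  chart_map y (sp_map s a) = sp_map s' (chart_map w a).
Proof.
have [U [Uw [t ->]]] := germ_surj a.
by rewrite sp_germ /chart_map !stalk_map_germ sp_germ; exact: germ_irr.
Qed.

(** Stalks at generizations are localizations: in an affine chart every germ at [y] is a quotient of
    global sections, and these have germs at [w] too. *)
Lemma chart_frac y w (s : specializes (k y) (k w)) (a : stalk (k y)) :
  exists b d, is_unit (sp_map s d) /\ a * sp_map s d = sp_map s b.
Proof.
have s' := (chart_specializes y w).1 s.
have [_ _ _ /(_ _ (chart_map y a))[d [f [ud e]]]] := affine_vanishing affY.
have [d0 d0E] := chart_map_surj (global_germ w d).
have [b bE] := chart_map_surj (global_germ w f).
have spE c c0 : chart_map w c0 = global_germ w c -> chart_map y (sp_map s c0) = global_germ y c.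
  by move=> h; rewrite (chart_map_sp _ s') h /global_germ sp_germ; exact: germ_irr.
exists b, d0; split.
  by apply: chart_map_unit; rewrite (spE _ _ d0E).
by apply: chart_map_inj; rewrite rmorphM /= (spE _ _ d0E) (spE _ _ bE).
Qed.

(** If no nonunit at [w] becomes a unit at [y], the two points have the same prime. *)
Lemma chart_sp_local y w (s : specializes (k y) (k w)) :
  (forall a, is_unit (sp_map s a) -> is_unit a) -> y = w.
Proof.
move=> sploc; have s' := (chart_specializes y w).1 s.
have [_ _ van_inj _] := affine_vanishing affY.
apply: van_inj; apply/seteqP; split; first exact: vanishing_specializes.
move=> b wb yb; apply: wb; have [a aE] := chart_map_surj (global_germ w b).
rewrite -aE; apply/rmorph_is_unit/sploc/chart_map_unit.
rewrite (chart_map_sp _ s') aE /global_germ sp_germ.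
by rewrite (germ_irr _ (I : oset (opensT Y) y)).
Qed.

(** The functions are generators of the prime of [w] in the chart. They come from sections on [X]
    only near [k w], so [V] is shrunk until its points all lie in the chart and the sections agree
    there with these generators. *)
Lemma chart_isolated w : max_noetherian (sect (opensT Y)) -> closed [set k w] ->
  exists (V : opens X) m (b : 'I_m -> sect V),
    oset V (k w) /\
    (forall (Vw : oset V (k w)) i, nonunits (germ Vw (b i))) /\
    forall p (Vp : oset V p), (forall i, nonunits (germ Vp (b i))) -> p = k w.
Proof.
move=> noethY /closed_point kwcl.
have wcl w' : specializes w w' -> w' = w.
  by move=> /chart_specializes/kwcl; have [kinj _ _] := immk => /kinj.
have [m [c [cw c0]]] := affine_common_zero affY noethY wcl.
have lift (i : 'I_m) : exists (V : opens X) (W : opens Y) (b : sect V)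
    (WV : W `<=` opreim (@mor_cont _ _ _ k) V),
    oset W w /\ res WV (pull k V b) = res (@opens_subT _ W) (c i).
  have [a aE] := chart_map_surj (global_germ w (c i)).
  have [V [Vw [b bE]]] := germ_surj a.
  move: aE; rewrite bE /chart_map stalk_map_germ => /germ_eq[W [h [h' [Ww e]]]].
  by exists V, W, b, h; split=> //; rewrite e (Prop_irrelevance h' (@opens_subT _ W)).
have [V [W [b [WV [Ww [bE VW]]]]]] : exists (V : opens X) (W : opens Y) (b : 'I_m -> sect V)
    (WV : W `<=` opreim (@mor_cont _ _ _ k) V),
    oset W w /\ (forall i, res WV (pull k V (b i)) = res (@opens_subT _ W) (c i))
    /\ V `<=` chart_image W.
  have [V0 [W0 [b0 [WV0 [Ww0 b0E]]]]] : exists (V : opens X) (W : opens Y) (b : 'I_m -> sect V)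
      (WV : W `<=` opreim (@mor_cont _ _ _ k) V),
      oset W w /\ (forall i, res WV (pull k V (b i)) = res (@opens_subT _ W) (c i)).
    elim: m c lift {cw c0} => [|m IH] c lift.
      exists (opensT X), (opensT Y), (fun=> 0), (fun _ _ => I).
      by split=> // -[].
    have [V1 [W1 [b1 [WV1 [Ww1 b1E]]]]] := lift ord0.
    have [V2 [W2 [b2 [WV2 [Ww2 b2E]]]]] := IH _ (fun i => lift (fintype.lift ord0 i)).
    pose V := opensI V1 V2; pose W := opensI W1 W2.
    have WV : W `<=` opreim (@mor_cont _ _ _ k) V by move=> y [/WV1 ? /WV2].
    pose b i := if unlift ord0 i is Some j then res (@opensIr _ V1 V2) (b2 j)
      else res (@opensIl _ V1 V2) b1.
    exists V, W, b, WV; split=> // i; rewrite /b; case: unliftP => [j|] ->.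
      rewrite (pull_res _ (fun y => @opensIr _ V1 V2 (k y))).
      rewrite (res_comp _ _ (subset_trans (@opensIr _ W1 W2) WV2)).
      rewrite -(res_comp WV2 (@opensIr _ W1 W2)) b2E.
      exact: res_comp.
    rewrite (pull_res _ (fun y => @opensIl _ V1 V2 (k y))).
    rewrite (res_comp _ _ (subset_trans (@opensIl _ W1 W2) WV1)).
    rewrite -(res_comp WV1 (@opensIl _ W1 W2)) b1E.
    exact: res_comp.
  have WV : W0 `<=` opreim (@mor_cont _ _ _ k) (opensI V0 (chart_image W0)).
    by move=> y Wy; split; [exact: (WV0 y Wy)|exists y].
  exists (opensI V0 (chart_image W0)), W0, (fun i => res (@opensIl _ _ _) (b0 i)), WV.
  split=> //; split=> [i|]; last exact: opensIr.
  rewrite (pull_res _ (fun y => @opensIl _ _ _ (k y))) (res_comp _ _ WV0).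
  exact: b0E.
have bgerm y (Wy : oset W y) (Vy : oset V (k y)) i :
    chart_map y (germ Vy (b i)) = global_germ y (c i).
  rewrite /chart_map stalk_map_germ -(germ_res WV _ Wy) bE.
  exact: germ_res.
exists V, m, b; split; first exact: (WV w Ww).
split=> [Vw i u|p Vp bp].
  by apply: (cw i); rewrite -(bgerm w Ww Vw); exact: rmorph_is_unit.
have [y Wy yp] := VW p Vp; rewrite -yp in Vp bp *.
congr (k _); apply: c0 => i; rewrite /vanishing /= -(bgerm y Wy Vp) => /chart_map_unit.
exact: bp.
Qed.

End Charts.

(** * Stalks of a primitive multiple curve *)

Section PrimeChains.
Variables (A B : comPzRingType) (f : {rmorphism A -> B}).

Lemma rmorph_inverse : bijective f ->
  exists g : {rmorphism B -> A}, cancel f g /\ cancel g f.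
Proof.
move=> [g fK gK].
pose g' : {rmorphism B -> A} := HB.pack g
  (GRing.isZmodMorphism.Build B A g (can2_zmod_morphism fK gK))
  (GRing.isMonoidMorphism.Build B A g (can2_monoid_morphism fK gK)).
by exists g'.
Qed.

Hypothesis frac : forall b, exists a d, is_unit (f d) /\ b * f d = f a.

(** Preimages of distinct nested primes stay distinct because a prime of [B] contains no unit [f d].
    This covers localizations and, with denominator 1, surjections. *)
Lemma prime_chain_frac d : prime_chain B d -> prime_chain A d.
Proof.
move=> [p [pP pS]]; exists (fun i => f @^-1` p i); split=> i id.
  have [[p0 pD pM] p1 pp] := pP i id; split.
  - split=> [|a b /= pa pb|a b /= pb]; first by rewrite /= rmorph0.
      by rewrite rmorphD; exact: pD.
    by rewrite rmorphM; exact: pM.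
  - by rewrite /= rmorph1.
  - by move=> a b; rewrite /= rmorphM => /pp.
have [psub npsub] := pS i id; split=> [a|sub]; first exact: psub.
apply: npsub => b pb; have [a [c [uc bc]]] := frac b.
have [[_ _ qM] _ _] := pP i.+1 id.
have [pid _ pp] := pP i (ltnW id).
have pa : p i (f a) by apply: sub; rewrite /= -bc mulrC; exact: qM.
move: pa; rewrite -bc => /pp[//|pc].
by have := prime_ideal_nonunits (pP i (ltnW id)) pc.
Qed.

End PrimeChains.

Section Varieties.
Variables (K : fieldType) (X : ringedSpace (K : comPzRingType)).
Hypothesis ftX : finite_type X.

Lemma finite_type_chart (x : X) : exists (Y : ringedSpace (K : comPzRingType))
  (k : morphism Y X) (y : Y),
  [/\ affine Y, max_noetherian (sect (opensT Y)), open_immersion k & k y = x].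
Proof.
have [m [Y [k [kP /(_ x)[i [y yx]]]]]] := ftX.
have [affY immk fgY] := kP i.
by exists (Y i), (k i), y; split=> //; exact: noetherian_fg_algebra fgY.
Qed.

(* Choose a closed point of one chart after the other: a chart that has been
   left is never met again. *)
Lemma closed_specialization (x : X) : exists p : X, specializes x p /\ closed [set p].
Proof.
have [m [Y [k [kP cov]]]] := ftX.
have : forall (i : 'I_m) y, specializes x (k i y) -> i \in enum 'I_m.
  by move=> i y _; rewrite mem_enum.
move: (enum 'I_m) => s; have [l] := ubnP (size s).
elim: l => // l IH in s x *; rewrite ltnS => sl sP.
have [i [y0 y0x]] := cov x.
have [affY immk fgY] := kP i.
have [y [y0y ycl]] := affine_closed_specialization y0 affY (noetherian_fg_algebra fgY).
have xy : specializes x (k i y) by rewrite -y0x; apply/(chart_specializes immk).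
have [ycl'|] := pselect (forall y', specializes (k i y) y' -> y' = k i y).
  by exists (k i y); split=> //; apply/closed_point.
move=> /existsNP[x' /not_implyP[yx' x'y]].
have is_ : i \in s by exact: sP xy.
have [|j w x'w|p [x'p pcl]] := IH (rem i s) x'.
- by rewrite size_rem//; case: s sl {sP} is_.
- have xw : specializes x (k j w).
    exact: specializes_trans xy (specializes_trans yx' x'w).
  have [ji|ji] := eqVneq j i; last by exact: rem_mem (sP _ _ xw).
  exfalso; apply: x'y; subst j.
  have wy : w = y.
    by apply/ycl/(chart_specializes immk); exact: specializes_trans yx' x'w.
  rewrite wy in x'w.
  have [w' _ w'x'] := x'w (chart_image immk (opensT (Y i))) (ex_intro2 _ _ y I erefl).
  rewrite -w'x'; congr (k i _); apply/ycl/(chart_specializes immk).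
  by rewrite w'x'.
- by exists p; split=> //; exact: specializes_trans xy (specializes_trans yx' x'p).
Qed.

Lemma sp_frac (x p : X) (h : specializes x p) (a : stalk x) :
  exists b d, is_unit (sp_map h d) /\ a * sp_map h d = sp_map h b.
Proof.
have [Y [k [w [affY _ immk wp]]]] := finite_type_chart p.
subst p.
have [y _ yx] := h (chart_image immk (opensT Y)) (ex_intro2 _ _ w I erefl).
by subst x; exact: chart_frac.
Qed.

Lemma sp_local_eq (x p : X) (h : specializes x p) :
  (forall a, is_unit (sp_map h a) -> is_unit a) -> x = p.
Proof.
have [Y [k [w [affY _ immk wp]]]] := finite_type_chart p.
subst p.
have [y _ yx] := h (chart_image immk (opensT Y)) (ex_intro2 _ _ w I erefl).
by subst x => hloc; congr (k _); exact: chart_sp_local hloc.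
Qed.

Lemma closed_point_isolated (p : X) : closed [set p] ->
  exists (V : opens X) m (b : 'I_m -> sect V),
    oset V p /\
    (forall (Vp : oset V p) i, nonunits (germ Vp (b i))) /\
    forall y (Vy : oset V y), (forall i, nonunits (germ Vy (b i))) -> y = p.
Proof.
have [Y [k [w [affY nY immk <-]]]] := finite_type_chart p.
exact: chart_isolated.
Qed.

End Varieties.

Section PrimitiveCurves.
Variables (K : fieldType) (n : nat) (X : ringedSpace (K : comPzRingType)).
Hypothesis hX : primitive_multiple_curve n X.

Lemma primitive_stalk_noeth (x : X) : max_noetherian (stalk x).
Proof. by have [_ /(_ x)[/noetherian_noeth]] := hX. Qed.

Lemma primitive_stalk_local (x : X) : local_ring (stalk x).
Proof. by have [_ /(_ x)[]] := hX. Qed.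

(** The local ring of the surface maps onto that of [X] by [kV \o iA] and onto that of [C] by [q].
    The kernel of [q] is the ideal of the curve; its generator [z] and the lift [t] are pushed to
    [X], where the [n]-th power of [z] vanishes by the definition of multiplicity. *)
Lemma primitive_stalk_closed (P : X) : closed [set P] -> exists t z : stalk P,
  [/\ dvr_quotient t z, z ^+ n = 0 &
      exists x : stalk P, nonunits x /\ forall a, x * a = 0 -> a = 0].
Proof.
move=> Pcl; have [_ cmX [C [j [[[jemb _ jsurj] jT _]]]]] := hX.
move=> [[_ _ regC] _] /(_ P Pcl)[U [S [k [i [p [kp [immk smS immi zP]]]]]]].
have [c jc] : exists c, j c = P.
  have : range j P by rewrite jT.
  by case=> c _ <-; exists c.
have ccl : closed [set c].
  apply/closed_point => y cy; have [jinj _] := jemb; apply: jinj.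
  have [] := closed_point P; rewrite jc => + _; apply => // V Vjy.
  by rewrite -jc; exact: (cy (opreim (@mor_cont _ _ _ j) V)).
have [_ locC [chainC _] [h mC]] := regC c ccl.
have [varS regS regS2] := smS.
have [e [noethB locB [chainB _] [g mB]]] := regS (i p).
(* Dimension 2 is given at closed points of [S], and [i p] is not known to be one; its stalk is a
   localization of the stalk at a closed specialization. *)
have e2 : (e <= 2)%N.
  rewrite leqNgt; apply/negP => e3.
  have [q [ipq qcl]] := closed_specialization varS.2 (i p).
  have [_ _ [_ n3] _] := regS2 q qcl; apply: n3.
  apply: (prime_chainW e3).
  exact: (prime_chain_frac (sp_frac varS.2 ipq)).
pose iA : {rmorphism stalk (i p) -> stalk p} := stalk_map (erefl (i p)).
pose kA : {rmorphism stalk P -> stalk p} := stalk_map kp.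
pose jA : {rmorphism stalk P -> stalk c} := stalk_map jc.
have iA_surj a : exists b, iA b = a by have [_ _ /(_ p)] := immi; exact.
have jA_surj : forall a, exists b, jA b = a.
  by rewrite /jA; case: _ / (jc) => a; exact: jsurj.
have kA_bij : bijective kA.
  by rewrite /kA; case: _ / (kp); have [_ _] := immk; exact.
have [kV [kK kVK]] := rmorph_inverse kA_bij.
pose q : {rmorphism stalk (i p) -> stalk c} := jA \o (kV \o iA).
have q_surj a : exists b, q b = a.
  have [a' <-] := jA_surj a; have [b bE] := iA_surj (kA a').
  by exists b; rewrite /= bE kK.
have locA := primitive_stalk_local P.
have [t [z [dvr kerE]]] := kernel_principal q_surj locB locC
  (noetherian_noeth noethB) e2 mB mC chainC.
have curveE : ideal_of_curve (i := i) jc kp = principal z.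
  rewrite -kerE; apply/seteqP; split=> [f [a [ka ja]]|f qf].
    by rewrite /= /iA /= -ka -/kA kK.
  by exists (kV (iA f)); split=> //; exact: kVK.
exists (kV (iA t)), (kV (iA z)); split.
- apply: (@dvr_quotient_surj _ _ (kV \o iA)) => //= a.
  have [b bE] := iA_surj (kA a).
  by exists b; rewrite /= bE kK.
- rewrite -!rmorphXn; have : ideal_of_neighbourhood (i := i) (p := p) (z ^+ n).
    by rewrite (zP c jc z curveE); exists 1; rewrite mul1r.
  by rewrite /ideal_of_neighbourhood /= => ->; rewrite rmorph0.
- have [_ _ [d [chainA nchainA] [[x xreg] _]]] := cmX P.
  (* The chain of two primes of the curve pulls back to [X]. Depth equals dimension, hence is
     positive, and a regular sequence has a first term. *)
  have d0 : (0 < d)%N.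
    rewrite lt0n; apply/eqP => d0; apply: nchainA; rewrite d0.
    apply: (prime_chain_frac (f := jA)) chainC => b.
    have [a <-] := jA_surj b; exists a, 1.
    by rewrite rmorph1 mulr1; split=> //; exact: is_unit1.
  have gen0 (a : stalk P) : generated (fun l : 'I_0 => x l) a <-> a = 0.
    split=> [[c' ->]|->]; first by rewrite big_ord0.
    by exists (fun=> 0); rewrite big_ord0.
  have [nx xr] := xreg 0%N d0.
  by exists (x 0%N); split=> // a xa; apply/gen0/xr/gen0.
Qed.

(* The elements outside (z) are the nonzerodivisors; by the last clause such an
   element is invertible on a punctured neighbourhood of x. *)
Lemma primitive_stalk (x : X) : exists (z : stalk x) N,
  [/\ z ^+ N.+1 = 0, forall a, z ^+ N * a = 0 -> principal z a,
      forall a d, ~ principal z a -> ~ principal z d ->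
        (exists q c, a = q * d + c * z) \/ (exists q c, d = q * a + c * z) &
      forall d, ~ principal z d -> exists (V : opens X) (Vx : oset V x) m (b : 'I_m -> sect V),
        (forall i, exists k c, germ Vx (b i) ^+ k = c * d) /\
        forall y (Vy : oset V y), (forall i, nonunits (germ Vy (b i))) -> y = x].
Proof.
have [[_ ftX] _ _] := hX.
have locA := primitive_stalk_local.
have [P [xP Pcl]] := closed_specialization ftX x.
have [t [z [dvr zn [r [nr rreg]]]]] := primitive_stalk_closed Pcl.
have [xeqP|xneP] := pselect (x = P).
  subst P.
  have [N [zN zann]] := dvr_quotient_ann (locA x) dvr zn nr rreg.
  exists z, N; split=> //.
    by move=> a d; exact: dvr_quotient_val dvr.
  move=> d zd; have [V [m [b [Vx [bx bP]]]]] := closed_point_isolated ftX Pcl.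
  exists V, Vx, m, b; split=> // i.
  by have := dvr_quotient_rad dvr zn zd (bx Vx i).
(* Now [P] is a proper specialization of [x], so some nonunit at [P] is a unit at [x]. Adding
   multiples of the nilpotent [z] does not change units, so [t] becomes a unit at [x], and then
   everything outside (z') does. *)
pose z' := sp_map xP z.
have unit_out (a : stalk x) : ~ principal z' a -> is_unit a.
  move=> za.
  have [s [us ns]] : exists s, is_unit (sp_map xP s) /\ nonunits s.
    apply: contrapT => H; apply: xneP; apply: (sp_local_eq ftX (h := xP)) => s us.
    by apply: contrapT => ns; apply: H; exists s.
  have [_ _ gen form] := dvr.
  have lift_unit s' c : is_unit (sp_map xP (s' + c * z)) -> is_unit (sp_map xP s').
    move=> u; apply: contrapT => ns'.
    have [_ nD _] := locA x; move: u; rewrite rmorphD rmorphM; apply: nD => //.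
    have [_ _ nM] := locA x; apply: nM => uz.
    have [w zw] := is_unitX n uz; move: zw; rewrite -rmorphXn zn rmorph0 mul0r.
    exact: local_neq01 (locA x).
  have ut : is_unit (sp_map xP t).
    have [x1 [x2 sE]] := gen _ ns.
    by move: us; rewrite sE => /lift_unit; rewrite mulrC rmorphM; exact: is_unitMl.
  have [b [d [ud adb]]] := sp_frac ftX xP a.
  have [|u [j [c [uu bE]]]] := form b.
    move=> [c bE]; apply: za; have [d' dd'] := ud.
    exists (sp_map xP c * d'); rewrite -[a]mulr1 -dd' mulrA adb bE rmorphM /z'; ring.
  apply: (@is_unitMl _ a (sp_map xP d)); rewrite adb.
  apply: contrapT => nb; have : is_unit (sp_map xP (b + (- c) * z)).
    have -> : b + - c * z = u * t ^+ j by rewrite bE; ring.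
    rewrite rmorphM rmorphXn; have [u' e1] := rmorph_is_unit (sp_map xP) uu.
    have [t' e2] := is_unitX j ut.
    by exists (u' * t'); rewrite mulrACA e1 e2 mulr1.
  by move/lift_unit.
have z'n : z' ^+ n = 0 by rewrite -rmorphXn zn rmorph0.
have [|[|N] zN Nmin] := @ex_minnP (fun n => z' ^+ n == 0).
- by exists n; rewrite z'n.
- by case: (local_neq01 (locA x)); apply/esym/eqP; rewrite -(expr0 z').
exists z', N; split.
- exact/eqP.
- move=> a za; apply: contrapT => /unit_out ua; move: za; rewrite mulrC.
  move=> /(is_unit_reg ua) zN0; have := Nmin N.
  by rewrite zN0 eqxx ltnn => /(_ isT).
- move=> a d _ /unit_out[d' dd']; left; exists (a * d'), 0.
  by rewrite mul0r addr0 -mulrA [d' * d]mulrC dd' mulr1.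
(* Since [d] is a unit, the single function 1, which has no zeros, serves with exponent 0. *)
- move=> d /unit_out[d' dd']; exists (opensT X), I, 1%N, (fun=> 1).
  split=> [i|y Vy n1].
    by exists 0%N, d'; rewrite expr0 mulrC dd'.
  by case: (n1 ord0); rewrite rmorph1; exact: is_unit1.
Qed.

End PrimitiveCurves.

(** * Sheaves of modules *)

Section ModuleSheaves.
Variables (K : comPzRingType) (X : ringedSpace K).
Implicit Types (M N : modSheaf X) (U V W : opens X).

Lemma mres_irr M U V (h h' : V `<=` U) (s : msect M U) : mres h s = mres h' s.
Proof. by rewrite (Prop_irrelevance h h'). Qed.

Lemma mres_comp2 M U V V' W (h : V `<=` U) (k : W `<=` V) (h' : V' `<=` U)
  (k' : W `<=` V') (s : msect M U) : mres k (mres h s) = mres k' (mres h' s).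
Proof. by rewrite (mres_comp _ _ (subset_trans k h)) (mres_comp _ _ (subset_trans k h)). Qed.

Lemma mres_sum M U V (h : V `<=` U) m (c : 'I_m -> sect U) (s : 'I_m -> msect M U) :
  mres h (\sum_i c i *: s i) = \sum_i res h (c i) *: mres h (s i).
Proof. by rewrite raddf_sum; apply: eq_bigr => i _; rewrite mresZ. Qed.

Lemma mres_local_eq M U (s t : msect M U) :
  (forall x, oset U x -> exists V (h : V `<=` U), oset V x /\ mres h s = mres h t) ->
  s = t.
Proof.
move=> st.
pose I := {V : opens X & {h : V `<=` U | mres h s = mres h t}}.
have [||r [_ ru]] := @mres_sheaf _ _ M U I (fun i => projT1 i)
  (fun i => sval (projT2 i)) (fun i => mres (sval (projT2 i)) s).
- move=> x /st[V [h [Vx e]]].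
  by exists (existT _ V (exist _ h e)).
- by move=> i j W hi hj; exact: mres_comp2.
by rewrite -(ru s (fun=> erefl)); apply: ru => -[V [h e]] /=; rewrite e.
Qed.

Lemma finite_nbhd x m (P : 'I_m -> opens X -> Prop) U : oset U x ->
  (forall i V W, W `<=` V -> P i V -> P i W) ->
  (forall i, exists V, oset V x /\ P i V) ->
  exists V, [/\ V `<=` U, oset V x & forall i, P i V].
Proof.
move=> Ux Pmon; elim: m => [|m IH] in P Pmon *; first by exists U; split=> // -[].
move=> PV; have [V1 [V1x P1]] := PV ord0.
have [|i|V2 [V2U V2x P2]] := IH (fun i => P (fintype.lift ord0 i)).
- by move=> i V W; exact: Pmon.
- exact: PV.
exists (opensI V1 V2); split=> // [y [_ /V2U//]|i].
case: (unliftP ord0 i) => [j|] ->;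
  [exact: (Pmon _ _ _ (@opensIr _ _ _) (P2 j))|exact: (Pmon _ _ _ (@opensIl _ _ _) P1)].
Qed.

Lemma finite_germs x m (a : 'I_m -> stalk x) U : oset U x ->
  exists V (Vx : oset V x) (c : 'I_m -> sect V), V `<=` U /\ forall i, germ Vx (c i) = a i.
Proof.
move=> Ux.
have [|i|V [VU Vx Va]] := @finite_nbhd x m
  (fun i V => forall Vx : oset V x, exists c, germ Vx c = a i) U Ux.
- move=> i V W WV VP Wx; have [c <-] := VP (WV x Wx).
  by exists (res WV c); exact: germ_res.
- have [V [Vx [s ->]]] := germ_surj (a i); exists V; split=> // Vx'.
  by exists s; exact: germ_irr.
have [c cP] := choice (fun i => Va i Vx).
by exists V, Vx, c.
Qed.

Lemma finite_germ_eq x m U (Ux : oset U x) (c d : 'I_m -> sect U) :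
  (forall i, germ Ux (c i) = germ Ux (d i)) ->
  exists V (h : V `<=` U), oset V x /\ forall i, res h (c i) = res h (d i).
Proof.
move=> cd; have [|i|V [VU Vx Va]] := @finite_nbhd x m
  (fun i V => exists h : V `<=` U, res h (c i) = res h (d i)) U Ux.
- move=> i V W WV [h e]; exists (subset_trans WV h).
  by rewrite -!(res_comp h WV) e.
- by have [V [h [Vx e]]] := germ_eq_res (cd i); exists V; split=> //; exists h.
exists V, VU; split=> // i; have [h e] := Va i.
by rewrite (Prop_irrelevance VU h).
Qed.

Lemma Hom_local_eq M N U (phi psi : homSect M N U) :
  (forall x, oset U x -> exists V (h : V `<=` U), oset V x /\
     forall W (hW : W `<=` V) s,
       happ phi (subset_trans hW h) s = happ psi (subset_trans hW h) s) ->
  phi = psi.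
Proof.
move=> loc; apply: homSect_eq => V h s; apply: mres_local_eq => x Vx.
have [W [hW [Wx e]]] := loc x (h x Vx).
pose k : opensI V W `<=` V := @opensIl _ V W.
exists (opensI V W), k; split=> //.
rewrite -!(happ_res _ h (subset_trans (@opensIr _ V W) hW)).
exact: e.
Qed.

Section GlueRelation.
Variables (M N : modSheaf X) (U : opens X).
Variable Q : forall V, msect M V -> msect N V -> Prop.
Hypothesis Qres : forall V W (h : W `<=` V) s t, Q s t -> Q (mres h s) (mres h t).
Hypothesis QD : forall V (s s' : msect M V) (t t' : msect N V),
  Q s t -> Q s' t' -> Q (s + s') (t + t').
Hypothesis QZ : forall V a (s : msect M V) (t : msect N V), Q s t -> Q (a *: s) (a *: t).
Hypothesis Q0 : forall V (t : msect N V), Q 0 t -> t = 0.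
Hypothesis Qtot : forall V (s : msect M V) x, V `<=` U -> oset V x ->
  exists W (h : W `<=` V), oset W x /\ exists t, Q (mres h s) t.

Let Ch V (s : msect M V) (t : msect N V) := forall x, oset V x ->
  exists W (h : W `<=` V), oset W x /\ Q (mres h s) (mres h t).

Let Quniq V (s : msect M V) t t' : Q s t -> Q s t' -> t = t'.
Proof.
move=> Qt Qt'; apply/eqP; rewrite -subr_eq0; apply/eqP/Q0.
by have := QD Qt (QZ (-1) Qt'); rewrite !scaleN1r subrr.
Qed.

Let Ch_uniq V (s : msect M V) t t' : Ch s t -> Ch s t' -> t = t'.
Proof.
move=> st st'; apply: mres_local_eq => x Vx.
have [W [h [Wx Qt]]] := st x Vx; have [W' [h' [Wx' Qt']]] := st' x Vx.
exists (opensI W W'), (subset_trans (@opensIl _ W W') h); split=> //.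
apply: (@Quniq _ (mres (subset_trans (@opensIl _ W W') h) s)).
  by rewrite -!(mres_comp h (@opensIl _ W W')); exact: Qres.
have e M' (r : msect M' V) : mres (subset_trans (@opensIl _ W W') h) r =
    mres (@opensIr _ W W') (mres h' r) by rewrite (mres_comp _ _ (subset_trans (@opensIl _ W W') h)).
by rewrite !e; exact: Qres.
Qed.

Let Ch_res V W (h : W `<=` V) (s : msect M V) t : Ch s t -> Ch (mres h s) (mres h t).
Proof.
move=> st x Wx; have [W' [h' [Wx' Qt]]] := st x (h x Wx).
exists (opensI W W'), (@opensIl _ W W'); split=> //.
by rewrite !(mres_comp2 h (@opensIl _ W W') h' (@opensIr _ W W')); exact: Qres.
Qed.

Let Ch_ex V (s : msect M V) : V `<=` U -> exists t, Ch s t.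
Proof.
move=> VU.
pose I := {W : opens X & {h : W `<=` V & {t | Q (mres h s) t}}}.
have [||t [tP _]] := @mres_sheaf _ _ N V I (fun i => projT1 i)
  (fun i => projT1 (projT2 i)) (fun i => sval (projT2 (projT2 i))).
- move=> x Vx; have [W [h [Wx [t Qt]]]] := Qtot s VU Vx.
  by exists (existT _ W (existT _ h (exist _ t Qt))).
- move=> [W [h [t Qt]]] [W' [h' [t' Qt']]] W0 hi' hj'.
  pose hi : W0 `<=` W := hi'; pose hj : W0 `<=` W' := hj'.
  change (mres hi t = mres hj t'); apply: (@Quniq _ (mres hi (mres h s))); first exact: Qres.
  by rewrite (mres_comp2 h hi h' hj); exact: Qres.
exists t => x Vx; have [W [h [Wx [u Qu]]]] := Qtot s VU Vx.
exists W, h; split=> //.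
by rewrite (tP (existT _ W (existT _ h (exist _ u Qu)))).
Qed.

(** [Q] prescribes values locally; additivity and [Q0] make them unique, so they agree on overlaps
    and glue. This serves to descend a map along [g] and to define a map by generators and
    relations. *)
Lemma hom_of_relation : exists phi : homSect M N U,
  forall V (h : V `<=` U) s t, Q s t -> happ phi h s = t.
Proof.
pose F V (h : V `<=` U) (s : msect M V) := sval (cid (Ch_ex s h)).
have FP V (h : V `<=` U) s : Ch s (F V h s) by rewrite /F; case: cid.
have Flin V (h : V `<=` U) : semilinear (F V h).
  split=> [a s|s s']; apply: (Ch_uniq (FP _ _ _)) => x Vx.
    have [W [k [Wx Qs]]] := FP V h s x Vx.
    by exists W, k; split=> //; rewrite !mresZ; exact: QZ.
  have [W [k [Wx Qs]]] := FP V h s x Vx; have [W' [k' [Wx' Qs']]] := FP V h s' x Vx.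
  exists (opensI W W'), (subset_trans (@opensIl _ W W') k); split=> //.
  rewrite !raddfD; apply: QD; first by rewrite -!(mres_comp k (@opensIl _ W W')); exact: Qres.
  have e M' (r : msect M' V) : mres (subset_trans (@opensIl _ W W') k) r =
    mres (@opensIr _ W W') (mres k' r) by rewrite (mres_comp _ _ (subset_trans (@opensIl _ W W') k)).
  by rewrite !e; exact: Qres.
pose Fl V (h : V `<=` U) : {linear msect M V -> msect N V} := HB.pack (F V h)
  (GRing.isSemilinear.Build (sect V) (msect M V) (msect N V) *:%R (F V h) (Flin V h)).
have Fres V W (hV : V `<=` U) (hW : W `<=` U) (h : W `<=` V) s :
    Fl W hW (mres h s) = mres h (Fl V hV s).
  by apply: (Ch_uniq (FP _ _ _)); apply/Ch_res/FP.
exists (HomSect Fres) => V h s t Qst /=; apply: (Ch_uniq (FP _ _ _)) => x Vx.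
by exists V, (@subset_refl _ _); split=> //; rewrite !mres_id.
Qed.

End GlueRelation.

(** * Left exactness of Hom *)

Section LeftExactness.
Variables (E F G N : modSheaf X) (f : modMorphism E F) (g : modMorphism F G).
Hypothesis exact_fg : short_exact f g.

Lemma short_exact_comp U (s : msect E U) : mmap g U (mmap f U s) = 0.
Proof.
have [_ /(_ U (mmap f U s))[_ +] _] := exact_fg; apply => x Ux.
by exists U, (@subset_refl _ _), s; split=> //; rewrite mres_id.
Qed.

Lemma Hom_map_inj U (phi : homSect G N U) : hom_comp g phi = 0 -> phi = 0.
Proof.
move=> phi0; apply: homSect_eq => V h r; apply: mres_local_eq => x Vx.
have [_ _ /(_ V r x Vx)[W [hW [t [Wx gt]]]]] := exact_fg.
exists W, hW; split=> //.
rewrite -!(happ_res _ h (subset_trans hW h)) -gt.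
exact: (congr1 (fun psi => happ psi (subset_trans hW h) t) phi0).
Qed.

(** A map that kills the image of [f] descends to [G] by evaluation on local preimages under [g]:
    exactness at [F] makes this well defined, local surjectivity of [g] makes it defined
    everywhere. *)
Lemma Hom_map_exact U (psi : homSect F N U) :
  hom_comp f psi = 0 <-> in_image (Hom_map N g) (psi : msect (Defs.Hom F N) U).
Proof.
split=> [psi0|im].
  pose Q V (r : msect G V) (t : msect N V) := exists (h : V `<=` U) (s : msect F V),
    mmap g V s = r /\ happ psi h s = t.
  have [|||||chi chiP] := @hom_of_relation G N U Q.
  - move=> V W h _ _ [hV [s [<- <-]]]; exists (subset_trans h hV), (mres h s).
    by rewrite mmap_res (happ_res _ hV).
  - move=> V _ _ _ _ [hV [s [<- <-]]] [hV' [s' [<- <-]]]; exists hV, (s + s').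
    by rewrite !raddfD (happ_irr _ hV' hV).
  - by move=> V a _ _ [hV [s [<- <-]]]; exists hV, (a *: s); rewrite !linearZ.
  - move=> V _ [hV [s [gs0 <-]]]; apply: mres_local_eq => x Vx.
    have [_ /(_ V s)[/(_ gs0 x Vx)[W [hW [e [Wx fe]]]] _] _] := exact_fg.
    exists W, hW; split=> //; rewrite -(happ_res _ hV (subset_trans hW hV)) -fe raddf0.
    exact: (congr1 (fun p => happ p (subset_trans hW hV) e) psi0).
  - move=> V r x VU Vx.
    have [_ _ /(_ V r x Vx)[W [hW [t [Wx gt]]]]] := exact_fg.
    exists W, hW; split=> //; exists (happ psi (subset_trans hW VU) t).
    by exists (subset_trans hW VU), t.
  move=> x Ux; exists U, (@subset_refl _ _), chi; split=> //.
  apply: homSect_eq => V h s /=; rewrite (happ_irr psi _ h).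
  by apply: chiP; exists h, s.
apply: Hom_local_eq => x Ux; have [V [h [chi [Vx chiE]]]] := im x Ux.
exists V, h; split=> // W hW s /=.
have := congr1 (fun p : homSect F N V => happ p hW (mmap f W s)) chiE.
by rewrite /= short_exact_comp raddf0 => ->.
Qed.

End LeftExactness.

End ModuleSheaves.

(** * Torsion freeness at a point *)

Section TorsionFree.
Variables (K : comPzRingType) (X : ringedSpace K) (G : modSheaf X).
Hypothesis tfG : torsion_free G.

(* Sections that vanish outside x form a subsheaf supported at x. *)
Lemma torsion_free_punctured (x : X) (U : opens X) (s : msect G U) :
  (forall y, oset U y -> y <> x ->
     exists (V : opens X) (h : V `<=` U), oset V y /\ mres h s = 0) -> s = 0.
Proof.
pose T (U : opens X) : set (msect G U) := [set s | forall y, oset U y -> y <> x ->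
  exists (V : opens X) (h : V `<=` U), oset V y /\ mres h s = 0].
have T0 U' : T U' 0.
  by move=> y Uy _; exists U', (@subset_refl _ _); rewrite raddf0.
have TD U' s1 s2 : T U' s1 -> T U' s2 -> T U' (s1 + s2).
  move=> T1 T2 y Uy yx; have [V [h [Vy e]]] := T1 y Uy yx.
  have [V' [h' [Vy' e']]] := T2 y Uy yx.
  exists (opensI V V'), (subset_trans (@opensIl _ V V') h); split=> //.
  rewrite raddfD -(mres_comp h (@opensIl _ V V')) e raddf0 add0r.
  by rewrite -(mres_comp h' (@opensIr _ V V')) e' raddf0.
have TZ U' a s1 : T U' s1 -> T U' (a *: s1).
  move=> T1 y Uy yx; have [V [h [Vy e]]] := T1 y Uy yx.
  by exists V, h; rewrite mresZ e scaler0.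
have Tres (U' V : opens X) (h : V `<=` U') s1 : T U' s1 -> T V (mres h s1).
  move=> T1 y Vy yx; have [W [k [Wy e]]] := T1 y (h y Vy) yx.
  exists (opensI V W), (@opensIl _ V W); split=> //.
  by rewrite (mres_comp2 h (@opensIl _ V W) k (@opensIr _ V W)) e raddf0.
have Tloc U' (s1 : msect G U') : (forall y, oset U' y -> exists (V : opens X) (h : V `<=` U'),
    oset V y /\ T V (mres h s1)) -> T U' s1.
  move=> loc y Uy yx; have [V [h [Vy TV]]] := loc y Uy.
  have [W [k [Wy e]]] := TV y Vy yx.
  by exists W, (subset_trans k h); split=> //; rewrite -(mres_comp h k).
pose TT := @SubmodSheaf K X G T T0 TD TZ Tres Tloc.
move=> Ts; apply: (tfG (T := TT)) => //.
apply: (@sub_finite_set _ _ [set x]) (finite_set1 x) => y [V [r [Vy Tr nz]]].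
apply: contrapT => yx; have [W [h [Wy e]]] := Tr y Vy yx.
exact: nz e.
Qed.

(** Near [x] a power of each [b i] is a multiple of [d] and so kills [w]. At any other nearby point
    some [b i] is invertible, so [w] vanishes there and [torsion_free_punctured] applies. *)
Lemma torsion_free_regular (x : X) (d : stalk x) (V : opens X) (Vx : oset V x) m
    (b : 'I_m -> sect V) :
  (forall i, exists k c, germ Vx (b i) ^+ k = c * d) ->
  (forall y (Vy : oset V y), (forall i, nonunits (germ Vy (b i))) -> y = x) ->
  forall (U : opens X) (Ux : oset U x) (d' : sect U) (w : msect G U),
    germ Ux d' = d -> d' *: w = 0 ->
    exists (W : opens X) (h : W `<=` U), oset W x /\ mres h w = 0.
Proof.
move=> bd bx U Ux d' w dE dw.
have [|i|W [WUV Wx WP]] := @finite_nbhd _ _ x m (fun i W =>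
  exists k (h : W `<=` V) (h' : W `<=` U), res h (b i) ^+ k *: mres h' w = 0)
  (opensI U V) (conj Ux Vx).
- move=> i W W' WW' [k [h [h' e]]].
  exists k, (subset_trans WW' h), (subset_trans WW' h').
  by rewrite -(mres_comp h' WW') -(res_comp h WW') -rmorphXn -mresZ e raddf0.
- have [k [c e]] := bd i; have [U' [Ux' [c' cE]]] := germ_surj c.
  pose W0 := opensI (opensI U V) U'.
  have W0x : oset W0 x by [].
  have hU : W0 `<=` U by move=> y [[]].
  have hV : W0 `<=` V by move=> y [[]].
  have hU' : W0 `<=` U' by move=> y [].
  have : germ W0x (res hV (b i) ^+ k) = germ W0x (res hU' c' * res hU d').
    rewrite rmorphXn rmorphM /= (germ_res hV Vx W0x) (germ_res hU' Ux' W0x).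
    by rewrite (germ_res hU Ux W0x) e cE dE.
  move=> /germ_eq_res[W [h [Wx e']]]; exists W; split=> //.
  exists k, (subset_trans h hV), (subset_trans h hU).
  rewrite -(res_comp hV h) -rmorphXn e' -(mres_comp hU h) -mresZ -scalerA.
  by rewrite -(mresZ hU) dw raddf0 scaler0 raddf0.
have hU : W `<=` U by move=> y /WUV[].
have hV : W `<=` V by move=> y /WUV[].
exists W, hU; split=> //; apply: (@torsion_free_punctured x) => y Wy yx.
have [i ui] : exists i, is_unit (germ (hV y Wy) (b i)).
  apply: contrapT => /forallNP n; apply: yx; exact: bx n.
have [k [h [h' e]]] := WP i.
move: ui; rewrite -(germ_res h (hV y Wy) Wy) => /germ_is_unit[W' [hW' [Wy' ub]]].
exists W', hW'; split=> //.
have [c bc] := is_unitX k ub.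
rewrite -[LHS]scale1r -bc mulrC -scalerA -rmorphXn -mresZ (mres_irr hU h') e.
by rewrite raddf0 scaler0.
Qed.

End TorsionFree.

(** * Extending a homomorphism near a point *)

Section LocalExtension.
Variables (K : comPzRingType) (X : ringedSpace K).
Variables (E F G : modSheaf X) (f : modMorphism E F) (g : modMorphism F G).
Hypothesis cohE : coherent E.
Hypothesis cohF : coherent F.
Hypothesis exact_fg : short_exact f g.

Variables (U : opens X) (phi : homSect E (structure_sheaf X) U) (x : X).
Hypothesis Ux : oset U x.

Variables (z : stalk x) (N : nat).
Hypothesis noethA : max_noetherian (stalk x).
Hypothesis zN : z ^+ N.+1 = 0.
Hypothesis z_ann : forall a, z ^+ N * a = 0 -> principal z a.
Hypothesis z_val : forall a d, ~ principal z a -> ~ principal z d ->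
  (exists q c, a = q * d + c * z) \/ (exists q c, d = q * a + c * z).
Hypothesis tf_x : forall d, ~ principal z d ->
  forall (V : opens X) (Vx : oset V x) (d' : sect V) (w : msect G V),
    germ Vx d' = d -> d' *: w = 0 ->
    exists (W : opens X) (h : W `<=` V), oset W x /\ mres h w = 0.

Lemma finite_type_at (M : modSheaf X) (U0 : opens X) : coherent M -> oset U0 x ->
  exists (V : opens X) r (s : 'I_r -> msect M V), [/\ V `<=` U0, oset V x &
    forall (W : opens X) (hW : W `<=` V) (t : msect M W) y, oset W y ->
    exists (W' : opens X) (hW' : W' `<=` W) (c : 'I_r -> sect W'), oset W' y /\
      mres hW' t = \sum_(i < r) c i *: mres (subset_trans hW' hW) (s i)].
Proof.
move=> [/(_ x I)[V [hV [r [s [Vx _ gen]]]]] _] U0x.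
exists (opensI V U0), r, (fun i => mres (@opensIl _ _ _) (s i ord0)).
split=> // [y []//|W hW t y Wy].
have [W' [hW' [c [Wy' e]]]] := gen W (subset_trans hW (@opensIl _ _ _)) (fun=> t) I y Wy.
exists W', hW', c; split=> //; rewrite (e ord0); apply: eq_bigr => i _; congr (_ *: _).
by rewrite (mres_comp _ _ (subset_trans hW' (subset_trans hW (@opensIl _ _ _)))).
Qed.

Section Generators.
Variables (V : opens X) (r : nat) (s : 'I_r -> msect F V).
Hypothesis VU : V `<=` U.
Hypothesis Vx : oset V x.

(* The partial map from stalk x ^ r to stalk x induced by phi on the preimage of
   the stalk of E under the map to the stalk of F given by the s i *)
Definition stalk_rel (v : 'rV[stalk x]_r) (b : stalk x) :=
  exists (W : opens X) (hW : W `<=` V) (Wx : oset W x) (c : 'I_r -> sect W) (e : msect E W),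
    [/\ forall i, germ Wx (c i) = v 0 i,
        mmap f W e = \sum_i c i *: mres hW (s i) &
        germ Wx (happ phi (subset_trans hW VU) e : sect W) = b].

Lemma stalk_rel_res (W W' : opens X) (hW : W `<=` V) (h : W' `<=` W)
    (Wx : oset W x) (Wx' : oset W' x) (hW' : W' `<=` V)
    (c : 'I_r -> sect W) (e : msect E W) (v : 'rV[stalk x]_r) b :
  [/\ forall i, germ Wx (c i) = v 0 i, mmap f W e = \sum_i c i *: mres hW (s i) &
      germ Wx (happ phi (subset_trans hW VU) e : sect W) = b] ->
  [/\ forall i, germ Wx' (res h (c i)) = v 0 i,
      mmap f W' (mres h e) = \sum_i res h (c i) *: mres hW' (s i) &
      germ Wx' (happ phi (subset_trans hW' VU) (mres h e) : sect W') = b].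
Proof.
move=> [cv fe eb]; split.
- by move=> i; rewrite (germ_res h Wx Wx').
- rewrite mmap_res fe mres_sum; apply: eq_bigr => i _.
  by rewrite (mres_comp hW h hW').
- by rewrite (happ_res phi (subset_trans hW VU)) /= (germ_res h Wx Wx').
Qed.

Lemma stalk_rel_lin : lin_rel stalk_rel.
Proof.
split.
- exists V, (@subset_refl _ _), Vx, (fun=> 0), 0; split.
  + by move=> i; rewrite mxE rmorph0.
  + by rewrite raddf0 big1// => i _; rewrite scale0r.
  + by rewrite !raddf0.
- move=> v w b c [W [hW [Wx [cv [e rv]]]]] [W' [hW' [Wx' [cw [e' rw]]]]].
  pose W0 := opensI W W'; have W0x : oset W0 x by [].
  have h0 : W0 `<=` V := subset_trans (@opensIl _ _ _) hW.
  have [v1 v2 v3] := stalk_rel_res (@opensIl _ W W') W0x h0 rv.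
  have [w1 w2 w3] := stalk_rel_res (@opensIr _ W W') W0x h0 rw.
  exists W0, h0, W0x, (fun i => res (@opensIl _ W W') (cv i) + res (@opensIr _ W W') (cw i)).
  exists (mres (@opensIl _ W W') e + mres (@opensIr _ W W') e'); split.
  + by move=> i; rewrite mxE rmorphD /= v1 w1.
  + by rewrite raddfD /= v2 w2 -big_split; apply: eq_bigr => i _; rewrite scalerDl.
  + by rewrite raddfD rmorphD /= v3 w3.
- move=> a v b [W [hW [Wx [cv [e rv]]]]]; have [W' [Wx' [a' ->]]] := germ_surj a.
  pose W0 := opensI W W'; have W0x : oset W0 x by [].
  have h0 : W0 `<=` V := subset_trans (@opensIl _ _ _) hW.
  have [v1 v2 v3] := stalk_rel_res (@opensIl _ W W') W0x h0 rv.
  pose a0 := res (@opensIr _ W W') a'.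
  exists W0, h0, W0x, (fun i => a0 * res (@opensIl _ W W') (cv i)), (a0 *: mres (@opensIl _ W W') e).
  split.
  + by move=> i; rewrite mxE rmorphM /= v1 /a0 (germ_res _ Wx' W0x).
  + by rewrite linearZ /= v2 scaler_sumr; apply: eq_bigr => i _; rewrite scalerA.
  + by rewrite linearZ /= -[_ *: _]/(a0 * _) rmorphM /= v3 /a0 (germ_res _ Wx' W0x).
(* Single-valuedness is the injectivity of [f]. *)
- move=> b [W [hW [Wx [c [e [c0 fe <-]]]]]].
  have [|W' [h [Wx' e']]] := @finite_germ_eq _ _ x r W Wx c (fun=> 0).
    by move=> i; rewrite c0 mxE rmorph0.
  have [finj _ _] := exact_fg.
  have e0 : mres h e = 0.
    apply: finj; rewrite mmap_res fe mres_sum big1// => i _.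
    by rewrite e' rmorph0 scale0r.
  rewrite -(germ_res h Wx Wx') -(happ_res phi _ (subset_trans (subset_trans h hW) VU) h) e0.
  by rewrite raddf0 rmorph0.
Qed.

(** If [d *: v] comes from [E], then [d] kills the image in [G] of the combination [w] with
    coefficients [v]. By [tf_x] this image vanishes near [x], and exactness lifts [w] to [E]. *)
Lemma stalk_rel_sat : saturated z (rel_dom stalk_rel).
Proof.
move=> d v zd [b [W [hW [Wx [c' [e [c'v fe _]]]]]]].
have [W1 [Wx1 [c [W1W cv]]]] := finite_germs (fun i => v 0 i) Wx.
have [W2 [Wx2 [d' dE]]] := germ_surj d.
pose W3 := opensI W1 W2; have Wx3 : oset W3 x by [].
have h1 : W3 `<=` W1 := @opensIl _ _ _; have h2 : W3 `<=` W2 := @opensIr _ _ _.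
have hW3 : W3 `<=` W := subset_trans h1 W1W.
have [|W4 [h4 [Wx4 eqc]]] := @finite_germ_eq _ _ x r W3 Wx3 (fun i => res hW3 (c' i))
  (fun i => res h2 d' * res h1 (c i)).
  move=> i; rewrite (germ_res hW3 Wx Wx3) c'v mxE rmorphM /=.
  by rewrite (germ_res h1 Wx1 Wx3) (germ_res h2 Wx2 Wx3) cv dE.
pose hWV4 : W4 `<=` V := subset_trans (subset_trans h4 hW3) hW.
pose c4 i := res h4 (res h1 (c i)); pose d4 := res h4 (res h2 d').
pose w := \sum_i c4 i *: mres hWV4 (s i).
have dw : d4 *: mmap g W4 w = 0.
  rewrite -linearZ /= (_ : d4 *: w = mmap f W4 (mres (subset_trans h4 hW3) e)).
    exact: short_exact_comp.
  rewrite mmap_res fe mres_sum scaler_sumr; apply: eq_bigr => i _.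
  by rewrite (mres_comp hW _ hWV4) scalerA -(res_comp hW3 h4) eqc rmorphM.
have [|W5 [h5 [Wx5 gw]]] := tf_x zd (Vx := Wx4) _ dw.
  by rewrite /d4 (germ_res h4 Wx3 Wx4) (germ_res h2 Wx2 Wx3).
have [_ /(_ _ (mres h5 w))[im _] _] := exact_fg.
have [|W6 [h6 [e' [Wx6 fe']]]] := im _ x Wx5; first by rewrite mmap_res.
pose h65 := subset_trans h6 h5.
exists (germ Wx6 (happ phi (subset_trans (subset_trans h65 hWV4) VU) e' : sect W6)).
exists W6, (subset_trans h65 hWV4), Wx6, (fun i => res h65 (c4 i)), e'; split=> //.
- move=> i; rewrite (germ_res h65 Wx4 Wx6) /c4 (germ_res h4 Wx3 Wx4).
  by rewrite (germ_res h1 Wx1 Wx3).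
- rewrite fe' (mres_comp h5 h6 h65) mres_sum; apply: eq_bigr => i _.
  by rewrite (mres_comp hWV4 h65 (subset_trans h65 hWV4)).
Qed.

Lemma stalk_extension : exists y : 'I_r -> stalk x,
  forall v b, stalk_rel v b -> b = \sum_(i < r) v 0 i * y i.
Proof. exact: (saturated_extension noethA zN z_ann z_val stalk_rel_lin stalk_rel_sat). Qed.

End Generators.

(** Three finite families turn germs into sections: generators of [F] place the problem in A^r,
    their relations make [psi] well defined, and generators of [E] reduce the equality with [phi] to
    finitely many germs. *)
Lemma hom_local_extension : exists (V : opens X) (h : V `<=` U)
  (psi : homSect F (structure_sheaf X) V), oset V x /\ hom_comp f psi = hom_res h phi.
Proof.
have [V1 [r [s [V1U V1x gen]]]] := finite_type_at cohF Ux.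
have [V2 [h2 [p [rho [V2x rel relgen]]]]] := cohF.2 V1 r s x V1x.
have V2U : V2 `<=` U := subset_trans h2 V1U.
have [y yP] := stalk_extension s V1U V1x.
have [V3 [V3x [eta0 [h3 eta0E]]]] := finite_germs y V2x.
(* A relation among the [s i] represents the zero section of [E], on which [phi] is zero, so the
   extension property of [y] applies to it. *)
have eta_rel l : germ V3x (\sum_i res h3 (rho l i) * eta0 i) = 0.
  have -> : germ V3x (\sum_i res h3 (rho l i) * eta0 i) =
      \sum_i (\row_i germ V2x (rho l i)) 0 i * y i.
    rewrite rmorph_sum; apply: eq_bigr => i _.
    by rewrite rmorphM /= (germ_res h3 V2x V3x) eta0E mxE.
  apply/esym/yP; exists V2, h2, V2x, (rho l), 0; split.
  - by move=> i; rewrite mxE.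
  - by rewrite raddf0; exact/esym/(rel l).
  - by rewrite !raddf0.
have [|V4 [h4 [V4x eta_rel4]]] := @finite_germ_eq _ _ x p V3 V3x
    (fun l => \sum_i res h3 (rho l i) * eta0 i) (fun=> 0).
  by move=> l; rewrite eta_rel rmorph0.
have [V5 [q [eps [V54 V5x epsgen]]]] := finite_type_at cohE V4x.
have V5V1 : V5 `<=` V1.
  exact: subset_trans V54 (subset_trans h4 (subset_trans h3 h2)).
have V5V3 : V5 `<=` V3 := subset_trans V54 h4.
have V5U : V5 `<=` U := subset_trans V5V1 V1U.
(* For each generator of [E] the formula for [phi] holds as an equality of germs at [x], hence of
   sections on a neighbourhood; finitely many neighbourhoods are intersected. *)
pose good j (W : opens X) := exists (h : W `<=` V5) (c : 'I_r -> sect W),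
  mmap f W (mres h (eps j)) = \sum_i c i *: mres (subset_trans h V5V1) (s i) /\
  (happ phi (subset_trans h V5U) (mres h (eps j)) : sect W) =
    \sum_i c i * res (subset_trans h V5V3) (eta0 i).
have [|j|V [VV5 Vx epsP]] := @finite_nbhd _ _ x q good V5 V5x.
- move=> j W W' WW' [h [c [fe pe]]]; exists (subset_trans WW' h), (fun i => res WW' (c i)).
  split.
    rewrite -(mres_comp h WW') mmap_res fe mres_sum; apply: eq_bigr => i _.
    by rewrite (mres_comp _ WW' (subset_trans (subset_trans WW' h) V5V1)).
  rewrite -(mres_comp h WW') (happ_res phi (subset_trans h V5U)) /= pe rmorph_sum.
  apply: eq_bigr => i _.
  by rewrite rmorphM /= (res_comp _ WW' (subset_trans (subset_trans WW' h) V5V3)).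
- have [W [hW [c [Wx fe]]]] := gen V5 V5V1 (mmap f V5 (eps j)) x V5x.
  have hWV1 := subset_trans hW V5V1; have hWV3 := subset_trans hW V5V3.
  have hWU := subset_trans hW V5U.
  have : germ Wx (happ phi hWU (mres hW (eps j)) : sect W) =
      germ Wx (\sum_i c i * res hWV3 (eta0 i)).
    rewrite rmorph_sum (yP (\row_i germ Wx (c i))
      (germ Wx (happ phi hWU (mres hW (eps j)) : sect W))).
      by apply: eq_bigr => i _; rewrite mxE rmorphM /= (germ_res hWV3 V3x Wx) eta0E.
    exists W, hWV1, Wx, c, (mres hW (eps j)); split.
    + by move=> i; rewrite mxE.
    + by rewrite mmap_res fe; apply: eq_bigr => i _; congr (_ *: _); exact: mres_irr.
    + by rewrite (happ_irr phi _ hWU).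
  move=> /germ_eq_res[W' [h [Wx' e]]]; exists W'; split=> //.
  exists (subset_trans h hW), (fun i => res h (c i)); split.
    rewrite -(mres_comp hW h) mmap_res mmap_res fe mres_sum; apply: eq_bigr => i _.
    by rewrite (mres_comp _ h (subset_trans (subset_trans h hW) V5V1)).
  rewrite -(mres_comp hW h) (happ_res phi hWU) /= e rmorph_sum; apply: eq_bigr => i _.
  by rewrite rmorphM /= (res_comp _ h (subset_trans (subset_trans h hW) V5V3)).
have VV1 : V `<=` V1 := subset_trans VV5 V5V1.
have VV3 : V `<=` V3 := subset_trans VV5 V5V3.
have VU : V `<=` U := subset_trans VV5 V5U.
pose Q W (t : msect F W) (u : msect (structure_sheaf X) W) :=
  exists (h : W `<=` V) (c : 'I_r -> sect W),
    t = \sum_i c i *: mres (subset_trans h VV1) (s i) /\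
    u = \sum_i c i * res (subset_trans h VV3) (eta0 i) :> sect W.
have Qres (W W' : opens X) (h : W' `<=` W) t u : Q W t u -> Q W' (mres h t) (mres h u).
  move=> [hW [c [-> ->]]]; exists (subset_trans h hW), (fun i => res h (c i)); split.
    rewrite mres_sum; apply: eq_bigr => i _.
    by rewrite (mres_comp _ h (subset_trans (subset_trans h hW) VV1)).
  rewrite /= rmorph_sum; apply: eq_bigr => i _.
  by rewrite rmorphM /= (res_comp _ h (subset_trans (subset_trans h hW) VV3)).
have [||||psi psiP] := @hom_of_relation _ _ F (structure_sheaf X) V Q Qres.
- move=> W _ _ _ _ [hW [c [-> ->]]] [hW' [c' [-> ->]]].
  exists hW, (fun i => c i + c' i); split.
    rewrite -big_split; apply: eq_bigr => i _.
    by rewrite scalerDl (mres_irr _ (subset_trans hW VV1)).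
  under [RHS]eq_bigr => i _ do rewrite mulrDl.
  by rewrite [RHS]big_split (Prop_irrelevance hW' hW).
- move=> W a _ _ [hW [c [-> ->]]]; exists hW, (fun i => a * c i); split.
    by rewrite scaler_sumr; apply: eq_bigr => i _; rewrite scalerA.
  by rewrite -[_ *: _]/(a * _) mulr_sumr; apply: eq_bigr => i _; rewrite mulrA.
(* Coefficients giving zero are locally combinations of the [rho l], whose pairing with [eta0] is
   zero by [eta_rel4]. *)
- move=> W _ [hW [c [c0 ->]]]; apply: mres_local_eq => w Ww.
  have WV2 : W `<=` V2 := subset_trans (subset_trans hW VV3) h3.
  have [|W' [hW' [d [Ww' cE]]]] := relgen W WV2 c _ w Ww.
    by rewrite [RHS]c0; apply: eq_bigr => i _; congr (_ *: _); exact: mres_irr.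
  exists W', hW'; split=> //; rewrite raddf0 /= rmorph_sum.
  have W'V4 : W' `<=` V4 := subset_trans hW' (subset_trans hW (subset_trans VV5 V54)).
  have W'V3 : W' `<=` V3 := subset_trans W'V4 h4.
  transitivity (\sum_l d l * res W'V4 (res h4 (\sum_i res h3 (rho l i) * eta0 i))).
    under [RHS]eq_bigr => l _ do rewrite (res_comp h4 W'V4 W'V3) rmorph_sum mulr_sumr.
    rewrite exchange_big; apply: eq_bigr => i _.
    rewrite rmorphM /= (res_comp _ hW' W'V3) [res hW' (c i)]cE mulr_suml.
    apply: eq_bigr => l _; rewrite rmorphM mulrA; congr (_ * _); congr (_ * _).
    exact/esym/res_comp.
  by rewrite big1// => l _; rewrite eta_rel4 !rmorph0 mulr0.
- move=> W t w WV Ww; have [W' [hW' [c [Ww' tE]]]] := gen W (subset_trans WV VV1) t w Ww.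
  exists W', hW'; split=> //.
  exists (\sum_i c i * res (subset_trans (subset_trans hW' WV) VV3) (eta0 i)).
  exists (subset_trans hW' WV), c; split=> //.
  by rewrite tE; apply: eq_bigr => i _; congr (_ *: _); exact: mres_irr.
exists V, VU, psi; split=> //; apply: homSect_eq => W hW e /=.
apply: (mres_local_eq (M := structure_sheaf X)) => w Ww.
have [W' [hW' [c [Ww' eE]]]] := epsgen W (subset_trans hW VV5) e w Ww.
exists W', hW'; split=> //.
have W'V := subset_trans hW' hW; have W'V5 := subset_trans W'V VV5.
rewrite -(happ_res psi hW W'V) -(happ_res phi _ (subset_trans W'V VU)).
rewrite -mmap_res eE !linear_sum /=; apply: eq_bigr => j _.
rewrite !linearZ /=; congr (_ * _).
have {eE}-> : mres (subset_trans hW' (subset_trans hW VV5)) (eps j) =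
    mres W'V (mres VV5 (eps j)).
  by rewrite (mres_comp _ _ W'V5); exact: mres_irr.
have [h [cj [fe pe]]] := epsP j.
have psie : happ psi (@subset_refl _ V) (mmap f V (mres VV5 (eps j))) =
    happ phi VU (mres VV5 (eps j)).
  apply: psiP; exists (@subset_refl _ V), cj; split.
    rewrite (mres_irr VV5 h) fe; apply: eq_bigr => i _; congr (_ *: _); exact: mres_irr.
  rewrite (mres_irr VV5 h) (happ_irr phi VU (subset_trans h V5U)) pe.
  by apply: eq_bigr => i _; rewrite (Prop_irrelevance (subset_trans h V5V3)
    (subset_trans (@subset_refl _ V) VV3)).
rewrite mmap_res (happ_res psi (@subset_refl _ V) W'V) (happ_res phi VU) psie.
by [].
Qed.

End LocalExtension.

(** * Exactness of the dual sequence *)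

Theorem mainTheorem9 (R : realType) (n : nat)
    (X : ringedSpace (R[i] : comPzRingType))
    (hX : primitive_multiple_curve n X)
    (E F G : modSheaf X) (f : modMorphism E F) (g : modMorphism F G)
    (cohE : coherent E) (cohF : coherent F) (cohG : coherent G)
    (tfE : torsion_free E) (tfF : torsion_free F) (tfG : torsion_free G)
    (exact_fg : short_exact f g) :
  short_exact (dual_map g) (dual_map f).
Proof.
split.
- exact: Hom_map_inj exact_fg.
- exact: Hom_map_exact exact_fg.
- move=> U phi x Ux.
  have [z [N [zN z_ann z_val z_out]]] := @primitive_stalk R[i] n X hX x.
  have noethA := @primitive_stalk_noeth R[i] n X hX x.
  have [d zd V Vx d' w dE dw|V [h [psi [Vx e]]]] :=
    hom_local_extension cohE cohF exact_fg phi Ux noethA zN z_ann z_val.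
    have [V' [Vx' [m [b [bd bx]]]]] := z_out d zd.
    exact: (torsion_free_regular tfG bd bx dE dw).
  by exists V, h, psi.
Qed.
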